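(* Let $H\in C^2(\mathbb R^d\times\mathbb R^d\times\mathscr P_2(\mathbb R^d))$, written $H(x,p,\mu)$, satisfy $D^2_{pp}H\ge c_0I_d$ for some $c_0>0$, and assume that $D^2_{x\mu}H$, $D^2_{xx}H$, $D^2_{pp}H$, $D^2_{p\mu}H$ are uniformly bounded. Suppose that for any $X,\delta X,P\in\mathbb L^2(\mathcal F_T)$ with $\mathcal L_X=\mu\in\mathscr P_2(\mathbb R^d)$, $$\mathbb E\Big[\big\langle\tilde{\mathbb E}[D^2_{x\mu}H(X,P,\mu,\tilde X)\delta\tilde X],\delta X\big\rangle+\langle D^2_{xx}H(X,P,\mu)\delta X,\delta X\rangle\Big]\le-\frac14\mathbb E\Big[\Big|[D^2_{pp}H(X,P,\mu)]^{-\frac12}\,\tilde{\mathbb E}[D^2_{p\mu}H(X,P,\mu,\tilde X)\delta\tilde X]\Big|^2\Big],$$ where $(\tilde X,\delta\tilde X)$ is an independent copy of $(X,\delta X)$ and $\tilde{\mathbb E}$ is the (conditional) expectation corresponding to $(\tilde X,\delta\tilde X)$. Then for any $X^1,X^2,P^1,P^2\in\mathbb L^2(\mathcal F_T)$ with $\mathcal L_{X^1}=\mu_1\in\mathscr P_2(\mathbb R^d)$ and $\mathcal L_{X^2}=\mu_2\in\mathscr P_2(\mathbb R^d)$, $$\mathbb E\Big\{\big(-D_xH(X^1,P^1,\mu_1)+D_xH(X^2,P^2,\mu_2)\big)\cdot(X^1-X^2)\Big\}+\mathbb E\Big\{\big(D_pH(X^1,P^1,\mu_1)-D_pH(X^2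,P^2,\mu_2)\big)\cdot(P^1-P^2)\Big\}\ge0.$$
   Context: $\mathscr P_2(\mathbb R^d)$ is the set of Borel probability measures on $\mathbb R^d$ with finite second moment, with the 2-Wasserstein distance $W_2$. $(\Omega,\mathbb F,\mathbb P)$, $\mathbb F=\{\mathcal F_t\}_{0\le t\le T}$, is a filtered probability space such that $\mathbb P$ has no atom in $\mathcal F_0$ (so every element of $\mathscr P_2(\mathbb R^d)$ is the law of some random variable). $\mathbb L^2(\mathcal F_T)$ is the set of $\mathbb R^d$-valued, $\mathcal F_T$-measurable square-integrable random variables, and $\mathcal L_\xi$ is the law of $\xi$. $U:\mathscr P_2(\mathbb R^d)\to\mathbb R$ is differentiable at $\mu$ if there is a Wasserstein gradient $D_\mu U(\mu,\cdot)\in\overline{\nabla C_c^\infty(\mathbb R^d)}^{L^2(\mu)}$ with $U(\mathcal L_{\xi+\eta})-U(\mathcal L_\xi)=\mathbb E[\langle D_\mu U(\mu,\xi),\eta\rangle]+o(\|\eta\|_2)$ for $\xi,\eta\in\mathbb L^2(\mathcal F_T)$ with $\mathcal L_\xi=\mu$. $H\in C^2$ means twice continuously differentiable in $(x,p,\mu)$ in this sense; $D^2_{x\mu}H(x,p,\mu,\tilde x)$ and $D^2_{p\mu}H(x,p,\mu,\tilde x)$ are the (matrix-valued) Wasserstein derivatives in $\mu$, evaluated at $\tilde x$, of $D_xH(x,p,\cdot)$ and $D_pH(x,p,\cdot)$.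
   Formalization: Since the mixed derivative of H in x and p is not assumed bounded, the two expectations in the conclusion may be −∞ and +∞; the inequality is stated for the expectation of the sum of the two integrands always, and for the sum of the two expectations when both integrands are integrable. *)

(* Defs.v *)
From HB Require Import structures.
From mathcomp Require Import all_boot all_order all_algebra.
From mathcomp Require Import all_classical all_reals all_analysis.

Set Implicit Arguments.
Unset Strict Implicit.
Unset Printing Implicit Defensive.

Import Order.TTheory GRing.Theory Num.Theory.
Import numFieldNormedType.Exports.

Local Open Scope classical_set_scope.
Local Open Scope ring_scope.

(* Vectors of R^d are row vectors and matrices act on the right: the
   derivative of a vector-valued F is the matrix with (i, j) entry d_i F_j, so
   that the product usually written DF(x) v is v *m DF x. *)

Section Euclidean.
Variables (R : realType) (d : nat).
Local Notation V := 'rV[R]_d.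

Definition dotp (u v : V) : R := \sum_(i < d) u 0 i * v 0 i.

Definition sqnorm (u : V) : R := dotp u u.

Definition grad (f : V -> R) (x : V) : V :=
  \row_(i < d) 'D_(delta_mx 0 i) f x.

Definition jac (F : V -> V) (x : V) : 'M[R]_d :=
  \matrix_(i < d, j < d) grad (fun y => F y 0 j) x 0 i.

Definition iter_partial (s : seq 'I_d) (f : V -> R) : V -> R :=
  foldr (fun i g x => grad g x 0 i) f s.

Definition smooth (f : V -> R) : Prop :=
  forall (s : seq 'I_d) (x : V), differentiable (iter_partial s f) x.

Definition Cc_infty (f : V -> R) : Prop :=
  smooth f /\ compact (closure [set x | f x != 0]).

Definition psdmx (A : 'M[R]_d) : Prop :=
  A^T = A /\ forall v : V, 0 <= dotp (v *m A) v.

(* The positive semidefinite square root, meaningful when A is positive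
   semidefinite. *)
Definition sqrtmx (A : 'M[R]_d) : 'M[R]_d :=
  get [set S : 'M[R]_d | psdmx S /\ S *m S = A].

Definition invsqrtmx (A : 'M[R]_d) : 'M[R]_d := invmx (sqrtmx A).

Definition borelRd := g_sigma_algebraType (@open V).

End Euclidean.

Section Wasserstein_space.
Variables (R : realType) (d : nat).
Local Notation V := 'rV[R]_d.
Local Notation B := (borelRd R d).

(* A measure of the library is a function on all sets, so a Borel measure has
   several representatives in this type. They are at W2-distance 0 from one
   another, hence W2-continuous functions do not distinguish them; has_law
   below only looks at Borel sets. *)
Record P2space := MkP2space {
  P2_measure :> probability B R ;
  P2_moment : (\int[P2_measure]_x (sqnorm (x : V))%:E < +oo)%E }.

Definition coupling (mu nu : P2space) (pi : probability (B * B)%type R) :=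
  (forall A : set B, measurable A -> pi (A `*` setT) = mu A) /\
  (forall A : set B, measurable A -> pi (setT `*` A) = nu A).

Definition W2 (mu nu : P2space) : \bar R :=
  sqrte (ereal_inf
    [set c | exists2 pi : probability (B * B)%type R, coupling mu nu pi &
      c = (\int[pi]_z (sqnorm ((z.1 : V) - (z.2 : V)))%:E)%E]).

Definition jcontinuous (Z S : normedModType R) (f : Z -> P2space -> S) : Prop :=
  forall z mu (e : R), 0 < e -> exists2 delta : R, 0 < delta &
    forall z' mu', `|z - z'| < delta -> (W2 mu mu' < delta%:E)%E ->
      `|f z mu - f z' mu'| < e.

(* The closure in L^2(mu) of the gradients of test functions. *)
Definition tangent (mu : P2space) (g : V -> V) : Prop :=
  [/\ measurable_fun [set: B] (g : B -> B),
      (\int[mu]_y (sqnorm (g (y : V)))%:E < +oo)%E &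
      forall e : R, 0 < e -> exists2 phi : V -> R, Cc_infty phi &
        (\int[mu]_y (sqnorm (g (y : V) - grad phi (y : V)))%:E < e%:E)%E].

End Wasserstein_space.

Section Probability.
Context {R : realType} {d : nat} {dO : measure_display}
  {Omega : measurableType dO}.
Variable P : probability Omega R.
Local Notation V := 'rV[R]_d.
Local Notation B := (borelRd R d).

Definition filtration (T : R) (F : R -> set (set Omega)) : Prop :=
  [/\ forall t, 0 <= t <= T -> sigma_algebra setT (F t),
      forall t, 0 <= t <= T -> F t `<=` measurable &
      forall s t, 0 <= s -> s <= t -> t <= T -> F s `<=` F t].

Definition no_atom (G : set (set Omega)) : Prop :=
  forall A, G A -> (0 < P A)%E ->
    exists2 A', G A' /\ A' `<=` A & (0 < P A')%E /\ (P A' < P A)%E.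

(* Square-integrable, measurable with respect to the sigma-algebra G. *)
Definition L2 (G : set (set Omega)) (X : Omega -> V) : Prop :=
  (forall A : set B, measurable A -> G (X @^-1` A)) /\
  ('E_P[fun w => sqnorm (X w)] < +oo)%E.

Definition L2norm (X : Omega -> V) : \bar R :=
  sqrte 'E_P[fun w => sqnorm (X w)].

Definition has_law (X : Omega -> V) (mu : P2space R d) : Prop :=
  forall A : set B, measurable A -> P (X @^-1` A) = mu A.

Definition expect_vec (Y : Omega -> V) : V :=
  \row_(j < d) fine 'E_P[fun w => Y w 0 j].

(* The independent copy of (X, dX) lives on the second factor of
   Omega * Omega, so the expectation over the copy, X, Q and dX being fixed,
   is an integral over that factor; this is the function
   w |-> E~[ M(X, Q, mu, X~) dX~ ](w). *)
Definition copy_expect (M : V -> V -> P2space R d -> V -> 'M[R]_d)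
    (X Q : Omega -> V) (mu : P2space R d) (dX : Omega -> V) (w : Omega) : V :=
  expect_vec (fun w' => dX w' *m M (X w) (Q w) mu (X w')).

(* g is the Wasserstein gradient of U at mu; G is the sigma-algebra of the
   random variables along which U is differentiated. *)
Definition is_wgrad (G : set (set Omega)) (U : P2space R d -> R)
    (mu : P2space R d) (g : V -> V) : Prop :=
  tangent mu g /\
  forall xi, L2 G xi -> has_law xi mu ->
  forall e : R, 0 < e -> exists2 delta : R, 0 < delta &
    forall eta (nu : P2space R d), L2 G eta -> (L2norm eta < delta%:E)%E ->
      has_law (fun w => xi w + eta w) nu ->
      (`|U nu - U mu - fine 'E_P[fun w => dotp (g (xi w)) (eta w)]|%:E
        <= e%:E * L2norm eta)%E.

End Probability.

Section Hamiltonian.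
Context {R : realType} {d : nat}.
Local Notation V := 'rV[R]_d.
Local Notation P2 := (P2space R d).

Definition Dx (H : V -> V -> P2 -> R) (x p : V) (mu : P2) : V :=
  grad (fun y => H y p mu) x.
Definition Dp (H : V -> V -> P2 -> R) (x p : V) (mu : P2) : V :=
  grad (fun q => H x q mu) p.
Definition Dxx (H : V -> V -> P2 -> R) (x p : V) (mu : P2) : 'M[R]_d :=
  jac (fun y => Dx H y p mu) x.
Definition Dpp (H : V -> V -> P2 -> R) (x p : V) (mu : P2) : 'M[R]_d :=
  jac (fun q => Dp H x q mu) p.

Context {dO : measure_display} {Omega : measurableType dO}.
Variables (P : probability Omega R) (G : set (set Omega)).

(* U(x, p, mu, y) is C^1 in (x, p, mu), with derivatives continuous in all
   variables, y included, and with Wasserstein gradient g(x, p, mu, y, .).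
   The variable y is only there for U = D_mu H(x, p, mu, y). The gradient
   D_mu U(mu, .) is determined mu-almost everywhere; g is its jointly
   continuous version. *)
Record is_C1_param (U : V -> V -> P2 -> V -> R)
    (g : V -> V -> P2 -> V -> V -> V) : Prop := {
  C1_cont : jcontinuous
    (fun (z : V * V * V) mu => U z.1.1 z.1.2 mu z.2) ;
  C1_diff_x : forall x p mu y, differentiable (fun x' => U x' p mu y) x ;
  C1_diff_p : forall x p mu y, differentiable (fun p' => U x p' mu y) p ;
  C1_cont_x : jcontinuous
    (fun (z : V * V * V) mu =>
      Dx (fun x p nu => U x p nu z.2) z.1.1 z.1.2 mu) ;
  C1_cont_p : jcontinuous
    (fun (z : V * V * V) mu =>
      Dp (fun x p nu => U x p nu z.2) z.1.1 z.1.2 mu) ;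
  C1_diff_mu : forall x p mu y,
    is_wgrad P G (fun nu => U x p nu y) mu (g x p mu y) ;
  C1_cont_mu : jcontinuous
    (fun (z : V * V * V * V) mu => g z.1.1.1 z.1.1.2 mu z.1.2 z.2) }.

Definition is_C1 (U : V -> V -> P2 -> R) (g : V -> V -> P2 -> V -> V) : Prop :=
  is_C1_param (fun x p mu _ => U x p mu) (fun x p mu _ => g x p mu).

(* Column j of Dxmu is the Wasserstein gradient of the j-th component of
   D_x H; likewise for Dpmu and Dmumu. *)
Record is_C2 (H : V -> V -> P2 -> R) (Dmu : V -> V -> P2 -> V -> V)
    (Dxmu Dpmu : V -> V -> P2 -> V -> 'M[R]_d)
    (Dmumu : V -> V -> P2 -> V -> V -> 'M[R]_d) : Prop := {
  C2_C1 : is_C1 H Dmu ;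
  C2_x : forall j : 'I_d, is_C1 (fun x p mu => Dx H x p mu 0 j)
    (fun x p mu y => (col j (Dxmu x p mu y))^T) ;
  C2_p : forall j : 'I_d, is_C1 (fun x p mu => Dp H x p mu 0 j)
    (fun x p mu y => (col j (Dpmu x p mu y))^T) ;
  C2_mu : forall j : 'I_d, is_C1_param (fun x p mu y => Dmu x p mu y 0 j)
    (fun x p mu y y' => (col j (Dmumu x p mu y y'))^T) }.

End Hamiltonian.

(* Main.v *)
Require Import Defs.
From HB Require Import structures.
From mathcomp Require Import all_boot all_order all_algebra.
From mathcomp Require Import all_classical all_reals all_analysis measurable_realfun.
From mathcomp Require complex.
From mathcomp Require Import ring lra.

Set Implicit Arguments.
Unset Strict Implicit.
Unset Printing Implicit Defensive.

Import Order.TTheory GRing.Theory Num.Theory.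
Import numFieldNormedType.Exports.

Local Open Scope classical_set_scope.
Local Open Scope ring_scope.

(* Interpolate X_s = X2 + s (X1 - X2), Q_s = Q2 + s (Q1 - Q2), and for fixed w
   let h_w(s) = D_pH(X_s, Q_s, L(X_s)) . (Q1 - Q2) - D_xH(X_s, Q_s, L(X_s)) .
   (X1 - X2), so that the quantity to bound is E[h(1) - h(0)]. In h_w'(s) the two
   terms with the mixed derivative D_xp H, which is not assumed bounded, cancel by
   Schwarz's theorem; what is left is dominated by an integrable function of w
   uniformly in s, so s |-> E[h(s) - h(0)] has derivative E[h'(s)]. Finally
   E[h'(s)] >= 0: completing the square in Q1 - Q2 with the square root of D_ppH
   produces exactly the right-hand side of the monotonicity hypothesis. *)

(** * Square roots of positive semidefinite matrices *)

(** Increments h(s) - h(0) are integrated because h(s) itself need not be integrable: with no bound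
    on D_xp H, nothing makes D_xH(X_s, Q_s, L(X_s)) or D_pH(X_s, Q_s, L(X_s)) square-integrable, and
    only the cancellation of the mixed terms controls the increment. For the same reason the
    inequality is first proved for the expectation of the sum, and is split into two expectations
    only when both terms are integrable. The law L(X_s) depends on s alone, so for fixed w the path
    is a curve in R^d x R^d x P_2, and differentiating it in the measure brings in an expectation
    over a copy of (X_s, X1 - X2). The hypothesis, used at (X_s, X1 - X2, Q_s), does not see u = Q1
    - Q2. With A = D_ppH and k the copy expectation of D_pmu H, the minimum over u of u A . u + k .
    u is - |k A^(-1/2)|^2 / 4; this is the origin of the constant 1/4. *)

Lemma poly_interpolation (F : fieldType) (s : seq F) (phi : F -> F) :
  exists p : {poly F}, forall x, x \in s -> p.[x] = phi x.
Proof.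
elim: s => [|x s [p ps]]; first by exists 0.
have [xs|xNs] := boolP (x \in s).
  by exists p => y; rewrite inE => /predU1P[->|]; exact: ps.
pose q := \prod_(y <- s) ('X - y%:P).
have qx : q.[x] != 0.
  by apply: contra xNs; rewrite -rootE root_prod_XsubC.
(* Newton's step: [q] vanishes at the earlier nodes, so their values are kept, and its coefficient
   corrects the value at [x]. *)
exists (p + ((phi x - p.[x]) / q.[x])%:P * q) => y; rewrite inE !hornerE.
have [->|_] /= := eqVneq y x; first by rewrite divfK// addrC subrK.
move=> ys; have /eqP -> : q.[y] == 0 by rewrite -rootE root_prod_XsubC.
by rewrite mulr0 addr0 ps.
Qed.

Lemma tr_horner_mx (F : comNzRingType) n (A : 'M[F]_n.+1) (p : {poly F}) :
  (horner_mx A p)^T = horner_mx A^T p.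
Proof.
elim/poly_ind: p => [|p c IH]; first by rewrite !rmorph0 trmx0.
rewrite !rmorphD !rmorphM /= !horner_mx_X !horner_mx_C linearD /= trmx_mul IH.
by rewrite tr_scalar_mx -!mulmxE (comm_horner_mx p (erefl (A^T *m A^T))).
Qed.

(** The diagonalisation lives over the larger field (the complex numbers below) and the polynomial
    over the smaller one; injectivity of [map_mx f] brings the identity back down. *)
Lemma horner_mx_id_on_spectrum (F K : fieldType) (f : {rmorphism F -> K}) n
    (A : 'M[F]_n.+1) (V : 'M[K]_n.+1) (D : 'rV[F]_n.+1) (p : {poly F}) :
  V \in unitmx -> map_mx f A = invmx V *m diag_mx (map_mx f D) *m V ->
  (forall j, p.[D 0 j] = D 0 j) -> horner_mx A p = A.
Proof.
move=> Vu AE pD; apply: (map_mx_inj (f := f)).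
rewrite map_horner_mx AE horner_mx_uconjC// horner_mx_diag.
suff -> : map_mx (horner (map_poly f p)) (map_mx f D) = map_mx f D by [].
by apply/rowP => j; rewrite !mxE horner_map pD.
Qed.

Section Square_root.
Variables (R : realType) (n : nat).
Implicit Types (A : 'M[R]_n) (u v : 'rV[R]_n).

Lemma dotpE u v : dotp u v = (u *m v^T) 0 0.
Proof. by rewrite mxE; apply: eq_bigr => i _; rewrite mxE. Qed.

Lemma dotpC u v : dotp u v = dotp v u.
Proof. by apply: eq_bigr => i _; rewrite mulrC. Qed.

Lemma dotp_trmx A u v : dotp (u *m A) v = dotp u (v *m A^T).
Proof. by rewrite !dotpE trmx_mul trmxK mulmxA. Qed.

Lemma dotpZl a u v : dotp (a *: u) v = a * dotp u v.
Proof. by rewrite !dotpE -scalemxAl mxE. Qed.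

Lemma dotpZr a u v : dotp u (a *: v) = a * dotp u v.
Proof. by rewrite dotpC dotpZl dotpC. Qed.

Lemma dotpDl u u' v : dotp (u + u') v = dotp u v + dotp u' v.
Proof. by rewrite !dotpE mulmxDl mxE. Qed.

Lemma dotpDr u u' v : dotp v (u + u') = dotp v u + dotp v u'.
Proof. by rewrite dotpC dotpDl !(dotpC v). Qed.

Lemma dotpNl u v : dotp (- u) v = - dotp u v.
Proof. by rewrite !dotpE mulNmx mxE. Qed.

Lemma sqnorm_ge0 u : 0 <= sqnorm u.
Proof. by apply: sumr_ge0 => i _; rewrite -expr2 sqr_ge0. Qed.

Lemma sqnorm_eq0 u : (sqnorm u == 0) = (u == 0).
Proof.
apply/eqP/eqP => [|->]; last by rewrite /sqnorm dotpE mul0mx mxE.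
move=> u0; apply/rowP => i; rewrite mxE; apply/eqP.
rewrite -sqrf_eq0 expr2.
have /(_ _) := @psumr_eq0P _ _ predT (fun i => u 0 i * u 0 i).
by move=> -> // j _; rewrite -expr2 sqr_ge0.
Qed.

Lemma psd_sqr A : A^T = A -> psdmx (A *m A).
Proof.
move=> AT; split; first by rewrite trmx_mul AT.
by move=> v; rewrite mulmxA dotp_trmx AT sqnorm_ge0.
Qed.

End Square_root.

Section Spectral_root.
Import complex.
Variables (R : realType).
Local Notation f := (real_complex R).

(** As [A] and [l] are real, the real and imaginary parts of [v] both satisfy the eigenvalue
    equation; one of them is nonzero, and pairing it with its image gives the sign of [l]. *)
Lemma psd_complex_eigenvalue_ge0 n (A : 'M[R]_n) (v : 'rV[R[i]%C]_n) (l : R) :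
  psdmx A -> v != 0 -> v *m map_mx f A = (f l) *: v -> 0 <= l.
Proof.
move=> [_ Apsd] v0 vA.
pose a := map_mx (@complex.Re R) v; pose b := map_mx (@complex.Im R) v.
have aA : a *m A = l *: a.
  apply/rowP => i; have /rowP/(_ i) := vA; rewrite !mxE.
  move/(congr1 (@complex.Re R)); rewrite (raddf_sum (@complex.Re R)) /=.
  case: (v 0 i) => x y /= ; rewrite !(mul0r, subr0) => <-.
  by apply: eq_bigr => j _; rewrite !mxE; case: (v 0 j) => x' y' /=;
     rewrite mulr0 subr0.
have bA : b *m A = l *: b.
  apply/rowP => i; have /rowP/(_ i) := vA; rewrite !mxE.
  move/(congr1 (@complex.Im R)); rewrite (raddf_sum (@complex.Im R)) /=.
  case: (v 0 i) => x y /= ; rewrite !(mul0r, addr0) => <-.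
  by apply: eq_bigr => j _; rewrite !mxE; case: (v 0 j) => x' y' /=;
     rewrite mulr0 add0r.
have key (c : 'rV[R]_n) : c != 0 -> c *m A = l *: c -> 0 <= l.
  rewrite -sqnorm_eq0 => c0 cA; have := Apsd c; rewrite cA dotpZl.
  by rewrite pmulr_lge0// lt_def c0 sqnorm_ge0.
have [a0|/key] := eqVneq a 0; last exact.
have [b0|/key] := eqVneq b 0; last exact.
case/negP: v0; apply/eqP/rowP => i.
have /rowP/(_ i) := a0; have /rowP/(_ i) := b0; rewrite !mxE.
by case: (v 0 i) => x y /= -> ->.
Qed.

(* The square root is p(A) ^ 2, where p is a real polynomial taking the value
   l^(1/4) at each eigenvalue l of A; squaring makes it positive. *)
Lemma psd_sqrt_exists n (A : 'M[R]_n) : psdmx A ->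
  exists S : 'M[R]_n, psdmx S /\ S *m S = A.
Proof.
case: n A => [|n] A Apsd.
  by exists A; split=> //; rewrite [LHS]thinmx0 [RHS]thinmx0.
pose B := map_mx f A.
have Breal : B \is a mxOver Num.real.
  by apply/mxOverP => i j; rewrite mxE; apply/complex_realP; exists (A i j).
have Bsym : B \is symmetricmx.
  apply/is_hermitianmxP; rewrite expr0 scale1r map_mx_id//.
  by rewrite /B -[X in X = _](congr1 (map_mx f) Apsd.1) map_trmx.
have Bherm := realsym_hermsym Bsym Breal.
have [V [Dr Vu Bspec]] : exists V, exists2 Dr : 'rV[R]_n.+1,
    V \in unitmx & B = invmx V *m diag_mx (map_mx f Dr) *m V.
  exists (spectralmx B), (map_mx (@complex.Re R) (spectral_diag B)).
    exact: spectral_unit.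
  rewrite -map_mx_comp map_mx_id_in.
    exact/orthomx_spectralP/hermitian_normalmx.
  move=> i j; rewrite /= RRe_real//.
  by have /mxOverP := hermitian_spectral_diag_real Bherm; exact.
have D_ge0 j : 0 <= Dr 0 j.
  (* Row [j] of the invertible [V] is a left eigenvector of [B] for the eigenvalue [Dr 0 j]. *)
  apply: (@psd_complex_eigenvalue_ge0 _ A (row j V)) => //.
    apply: contraTneq Vu => Vj0; rewrite -row_free_unit -kermx_eq0.
    apply/eqP => ker0; have : delta_mx 0 j *m V = (0 : 'rV[R[i]%C]_n.+1).
      by rewrite -rowE.
    move/sub_kermxP; rewrite ker0 submx0 => /eqP/rowP/(_ j).
    by rewrite !mxE !eqxx /= => /eqP; rewrite oner_eq0.
  rewrite -/B Bspec !mulmxA -row_mul mulmxV// row1.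
  by rewrite -!rowE row_diag_mx -scalemxAl -rowE mxE.
have [p pE] := poly_interpolation [seq Dr 0 j | j <- enum 'I_n.+1]
  (fun x => Num.sqrt (Num.sqrt x)).
have {}pE j : p.[Dr 0 j] ^+ 4 = Dr 0 j.
  rewrite pE ?map_f ?mem_enum// (exprM _ 2 2) sqr_sqrtr ?sqrtr_ge0//.
  by rewrite sqr_sqrtr.
pose Q := horner_mx A p.
have QT : Q^T = Q by rewrite tr_horner_mx Apsd.1.
exists (Q *m Q); split; first exact: psd_sqr.
have -> : Q *m Q *m (Q *m Q) = horner_mx A (p ^+ 4).
  by rewrite rmorphXn /= (exprM _ 2 2) !expr2 !mulmxE.
by rewrite (horner_mx_id_on_spectrum Vu Bspec)// => j; rewrite horner_exp pE.
Qed.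

End Spectral_root.

Section Completing_the_square.
Variables (R : realType) (n : nat).
Implicit Types (A : 'M[R]_n) (u k : 'rV[R]_n).

(** The coercivity estimate c |v|^2 <= vA . v leaves no nonzero vector in the kernel. *)
Lemma psd_shift A (c : R) : 0 < c -> psdmx (A - c%:M) ->
  psdmx A /\ A \in unitmx.
Proof.
move=> c0 [AT Ac].
have dA v : c * sqnorm v <= dotp (v *m A) v.
  have := Ac v; rewrite mulmxBr mul_mx_scalar dotpDl dotpNl dotpZl.
  by rewrite subr_ge0.
split.
  split=> [|v]; last by rewrite (le_trans _ (dA v))// mulr_ge0 ?sqnorm_ge0 ?ltW.
  by move: AT; rewrite linearB /= tr_scalar_mx => /addIr.
rewrite -row_free_unit -kermx_eq0; apply/eqP/row_matrixP => i.
rewrite row0; apply/eqP; rewrite -sqnorm_eq0 eq_le sqnorm_ge0 andbT.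
rewrite -(pmulr_rle0 _ c0) (le_trans (dA _))// -row_mul mulmx_ker row0.
by rewrite dotpE mul0mx mxE.
Qed.

(** With S the square root of A, the right-hand side is |u S + k S^(-1) / 2|^2: symmetry of S turns
    the cross term into k . u. *)
Lemma completed_square_ge0 A (c : R) u k : 0 < c -> psdmx (A - c%:M) ->
  0 <= dotp (u *m A) u + dotp k u + 4^-1 * sqnorm (k *m invsqrtmx A).
Proof.
move=> c0 /(psd_shift c0)[Apsd Au].
rewrite /invsqrtmx; set S := sqrtmx A.
have [[ST _] SS] : psdmx S /\ S *m S = A.
  exact: (getPex (psd_sqrt_exists Apsd)).
have Su : S \in unitmx by move: Au; rewrite -SS unitmx_mul andbb.
have := sqnorm_ge0 (u *m S + 2^-1 *: (k *m invmx S)).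
rewrite /sqnorm !(dotpDl, dotpDr, dotpZl, dotpZr).
rewrite [dotp (k *m invmx S) (u *m S)]dotpC.
have -> : dotp (u *m S) (u *m S) = dotp (u *m A) u.
  by rewrite -SS mulmxA [RHS]dotp_trmx ST.
have -> : dotp (u *m S) (k *m invmx S) = dotp k u.
  by rewrite dotpC dotp_trmx trmx_inv ST mulmxK.
by move=> /le_trans; apply; lra.
Qed.

End Completing_the_square.

(** * Borel measurability in R^d, square-integrable variables and W2 *)

Section Measurability.
Context {R : realType} {d : nat} {dT : measure_display} {T : measurableType dT}.
Local Notation V := 'rV[R]_d.
Local Notation B := (borelRd R d).

(** An open set is the union of the balls it contains with centre in the dense family and radius
    1/(k+1), and there are countably many of them. *)
Lemma measurable_preimage_separable (S : pseudoMetricType R) (Q : countType)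
    (e : Q -> S) (g : T -> S) (O : set S) :
  (forall x (r : R), 0 < r -> exists q, ball (e q) r x) ->
  (forall q (r : R), 0 < r -> measurable (g @^-1` ball (e q) r)) ->
  open O -> measurable (g @^-1` O).
Proof.
move=> eD gm Oo.
(* Balls not contained in [O] contribute the empty set, so that the union runs over a whole
   countable type. *)
pose U (i : Q * nat) : set T :=
  if `[< ball (e i.1) i.2.+1%:R^-1 `<=` O >]
  then g @^-1` ball (e i.1) i.2.+1%:R^-1 else set0.
have -> : g @^-1` O = \bigcup_i U i.
  apply/seteqP; split=> [t /= Ot|t [i _]]; last first.
    by rewrite /U; case: asboolP => // bO; exact: bO.
  have /nbhs_ballP[r r0 rO] : nbhs (g t) O by exact: open_nbhs_nbhs.
  have r20 : 0 < r / 2 by rewrite divr_gt0.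
  have [k kr] : exists k, k.+1%:R^-1 < r / 2.
    by have [k] := ltr_add_invr r20; rewrite add0r; exists k.
  have k0 : 0 < k.+1%:R^-1 :> R by rewrite invr_gt0.
  have [q qt] := eD (g t) _ k0.
  exists (q, k) => //; rewrite /U /=; case: asboolP => //; case=> y qy.
  apply: rO; apply: (@le_ball _ _ _ (k.+1%:R^-1 + k.+1%:R^-1)).
    by rewrite [leRHS](splitr r) lerD// ltW.
  exact: ball_triangle (ball_sym qt) qy.
apply: countable_bigcupT_measurable => [|i]; first exact: countableP.
by rewrite /U; case: asboolP => // _; apply: gm; rewrite invr_gt0.
Qed.

Lemma ratr_ball_dense (x r : R) : 0 < r -> exists q : rat, ball (ratr q : R) r x.
Proof.
move=> r0; have [|q] := @rat_in_itvoo R (x - r) (x + r); first by lra.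
rewrite in_itv /= => /andP[h1 h2]; exists q.
by rewrite /ball /= ltr_norml; lra.
Qed.

Lemma rV_ratr_ball_dense (x : V) (r : R) : 0 < r ->
  exists q : 'rV[rat]_d, ball (map_mx (@ratr R) q : V) r x.
Proof.
move=> r0; have [q qP] := choice (fun i => ratr_ball_dense (x 0 i) r0).
exists (\row_i q i); split=> // i j; rewrite !mxE ord1; exact: qP.
Qed.

(** Balls are those of the maximum norm, hence finite intersections of coordinate slabs. *)
Lemma measurable_preimage_rV_ball (g : T -> V) (x : V) (r : R) : 0 < r ->
  (forall i, measurable_fun setT (fun t => g t 0 i)) ->
  measurable (g @^-1` ball x r).
Proof.
move=> r0 mg.
have -> : g @^-1` ball x r = \bigcap_(i in [set: 'I_d])
    ((fun t => g t 0 i) @^-1` ball (x 0 i) r).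
  apply/seteqP; split=> [t [_ h] i _ /=|t h /=]; first exact: h.
  by split=> // i j; rewrite ord1; exact: h.
apply: fin_bigcap_measurable => // i _; rewrite -[X in measurable X]setTI.
by apply: mg => //; apply: open_measurable; exact: ball_open.
Qed.

Lemma measurable_rV (g : T -> V) :
  (forall i, measurable_fun setT (fun t => g t 0 i)) ->
  measurable_fun [set: T] (g : T -> B).
Proof.
move=> mg; apply: (@measurability _ _ T B setT g (@open V)) => //.
move=> _ [W Wo <-]; rewrite setTI.
apply: (measurable_preimage_separable rV_ratr_ball_dense) => // q r r0.
exact: measurable_preimage_rV_ball.
Qed.

Lemma measurable_rV_coord (g : T -> V) i :
  measurable_fun [set: T] (g : T -> B) ->
  measurable_fun setT (fun t => g t 0 i).
Proof.
move=> mg; apply: (measurability _ (RGenOpens.measurableE R)).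
move=> _ [_ [a [b ->]] <-]; 
apply: (mg measurableT ((fun v : V => v 0 i) @^-1` `]a, b[)).
apply: sub_sigma_algebra.
by have /continuousP := @coord_continuous R 1 d 0 i; apply; exact: interval_open.
Qed.

(** Covering open sets of the product by balls with rational centres avoids comparing the Borel
    sigma-algebra of the product with the product sigma-algebra. *)
Lemma measurable_continuous_rV2 (f : V * V -> R)
    (X Y : T -> V) : continuous f ->
  measurable_fun [set: T] (X : T -> B) -> measurable_fun [set: T] (Y : T -> B) ->
  measurable_fun setT (fun t => f (X t, Y t)).
Proof.
move=> cf mX mY; apply: (measurability _ (RGenOpens.measurableE R)).
move=> _ [_ [a [b ->]] <-]; rewrite setTI.
apply: (@measurable_preimage_separable (V * V)%type ('rV[rat]_d * 'rV[rat]_d)%type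
   (fun q => (map_mx (@ratr R) q.1, map_mx (@ratr R) q.2)) (fun t => (X t, Y t))
   (f @^-1` `]a, b[)).
- move=> [x y] r r0.
  have [q qx] := rV_ratr_ball_dense x r0; have [q' qy] := rV_ratr_ball_dense y r0.
  by exists (q, q').
- move=> [q q'] r r0.
  rewrite (_ : _ @^-1` _ =
    X @^-1` (ball (map_mx (@ratr R) q) r) `&`
    Y @^-1` (ball (map_mx (@ratr R) q') r)) //.
  by apply: measurableI; apply: measurable_preimage_rV_ball => // i;
    exact: measurable_rV_coord.
- by move/continuousP: cf; apply; exact: interval_open.
Qed.

Lemma measurable_dotp (X Y : T -> V) :
  measurable_fun [set: T] (X : T -> B) -> measurable_fun [set: T] (Y : T -> B) ->
  measurable_fun setT (fun t => dotp (X t) (Y t)).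
Proof.
move=> mX mY; apply: measurable_sum => i.
by apply: measurable_funM; exact: measurable_rV_coord.
Qed.

Lemma measurable_rV_lin (X Y : T -> V) (s : R) :
  measurable_fun [set: T] (X : T -> B) -> measurable_fun [set: T] (Y : T -> B) ->
  measurable_fun [set: T] ((fun t => X t + s *: Y t) : T -> B).
Proof.
move=> mX mY; apply: measurable_rV => i.
rewrite (_ : (fun _ => _) = (fun t => X t 0 i + s * Y t 0 i)); last first.
  by apply/funext => t; rewrite !mxE.
apply: measurable_funD; first exact: measurable_rV_coord.
by apply: measurable_funM => //; exact: measurable_rV_coord.
Qed.

Lemma measurable_sqnorm (X : T -> V) :
  measurable_fun [set: T] (X : T -> B) ->
  measurable_fun setT (fun t => (sqnorm (X t))%:E).
Proof. by move=> mX; apply/measurable_EFinP; exact: measurable_dotp. Qed.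

End Measurability.

Section Sqnorm.
Context {R : realType} {d : nat}.
Implicit Types u v : 'rV[R]_d.

Lemma sqnorm_lin_le u v (s : R) :
  sqnorm (u + s *: v) <= 2 * sqnorm u + 2 * s ^+ 2 * sqnorm v.
Proof.
have := sqnorm_ge0 (u + (- s) *: v).
by rewrite /sqnorm !(dotpDl, dotpDr, dotpZl, dotpZr) (dotpC v u); lra.
Qed.

Lemma sqnormZ (s : R) v : sqnorm (s *: v) = s ^+ 2 * sqnorm v.
Proof. by rewrite /sqnorm dotpZl dotpZr mulrA. Qed.

Lemma normr_dotp_le u v : `|dotp u v| <= sqnorm u + sqnorm v.
Proof.
have := sqnorm_ge0 (u + v); have := sqnorm_ge0 (u + (-1) *: v).
have := sqnorm_ge0 u; have := sqnorm_ge0 v.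
rewrite /sqnorm !(dotpDl, dotpDr, dotpZl, dotpZr) (dotpC v u) ler_norml.
by move=> *; apply/andP; split; lra.
Qed.

Lemma sqr_coord_le u i : u 0 i ^+ 2 <= sqnorm u.
Proof.
rewrite /sqnorm /dotp (bigD1 i) //= expr2 lerDl.
by apply: sumr_ge0 => j _; rewrite -expr2 sqr_ge0.
Qed.

(** Bounds affine in [sqnorm], like this one, turn square-integrability into domination by an
    integrable function without the Cauchy-Schwarz inequality. *)
Lemma normr_coord_le u i : `|u 0 i| <= 1 + sqnorm u.
Proof.
have := sqr_coord_le u i.
have := sqr_ge0 (u 0 i - 1); have := sqr_ge0 (u 0 i + 1).
by rewrite ler_norml => *; apply/andP; split; nra.
Qed.

End Sqnorm.

Section L2_space.
Context {R : realType} {d : nat} {dO : measure_display}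
  {Omega : measurableType dO}.
Variable P : probability Omega R.
Local Notation V := 'rV[R]_d.
Local Notation B := (borelRd R d).

Lemma expectation_sqnorm_ge0 (X : Omega -> V) : (0 <= 'E_P[fun w => sqnorm (X w)])%E.
Proof.
by rewrite unlock; apply: integral_ge0 => w _; rewrite lee_fin sqnorm_ge0.
Qed.

(** The joint law of (X, Y) is one of the couplings over which the infimum is taken. *)
Lemma W2_le_L2norm (X Y : Omega -> V) (mu nu : P2space R d) :
  measurable_fun [set: Omega] (X : Omega -> B) ->
  measurable_fun [set: Omega] (Y : Omega -> B) ->
  has_law P X mu -> has_law P Y nu ->
  (W2 mu nu <= L2norm P (fun w => (X w - Y w)%R))%E.
Proof.
move=> mX mY lX lY.
have mXY : measurable_fun [set: Omega] ((fun w => (X w, Y w)) : Omega -> B * B).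
  exact: measurable_fun_pair.
rewrite /W2 /L2norm lee_sqrt ?expectation_sqnorm_ge0 //.
apply: ereal_inf_lbound.
pose Z : {mfun Omega >-> (B * B)%type} := mfun_Sub (mem_set mXY).
exists (distribution P Z).
  by split=> A mA; rewrite /distribution /pushforward /= -?lX -?lY //;
    congr (P _); apply/seteqP; split=> w //= [].
rewrite unlock ge0_integral_distribution //.
  apply: (@measurable_sqnorm _ _ _ (B * B)%type (fun z => (z.1 : V) - (z.2 : V))).
  rewrite (_ : (fun _ => _) = (fun z : B * B => (z.1 : V) + (-1) *: (z.2 : V))).
    exact: measurable_rV_lin measurable_fst measurable_snd.
  by apply/funext => z; rewrite scaleN1r.
by move=> z; rewrite lee_fin sqnorm_ge0.
Qed.

Lemma has_law_exists (X : Omega -> V) :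
  measurable_fun [set: Omega] (X : Omega -> B) ->
  ('E_P[fun w => sqnorm (X w)] < +oo)%E -> exists mu : P2space R d, has_law P X mu.
Proof.
move=> mX X2; pose Z : {mfun Omega >-> B} := mfun_Sub (mem_set mX).
have Z2 : (\int[distribution P Z]_x (sqnorm (x : V))%:E < +oo)%E.
  move: X2; rewrite unlock ge0_integral_distribution //.
    by apply: (@measurable_sqnorm _ _ _ B id).
  by move=> z; rewrite lee_fin sqnorm_ge0.
by exists (@MkP2space R d (distribution P Z) Z2) => A mA.
Qed.

Variable G : set (set Omega).
Hypotheses (G_sigma : sigma_algebra setT G) (G_measurable : G `<=` measurable).

Lemma L2_measurable (X : Omega -> V) :
  L2 P G X -> measurable_fun [set: Omega] (X : Omega -> B).
Proof. by move=> [GX _] _ A mA; rewrite setTI; apply: G_measurable; exact: GX. Qed.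

Lemma L2_integrable (X : Omega -> V) :
  L2 P G X -> P.-integrable setT (fun w => (sqnorm (X w))%:E).
Proof.
move=> LX; apply/integrableP; split.
  by apply: measurable_sqnorm; exact: L2_measurable.
under eq_integral do rewrite gee0_abs ?lee_fin ?sqnorm_ge0 //.
by have [_] := LX; rewrite unlock.
Qed.

Lemma L2_lin (X Y : Omega -> V) (s : R) :
  L2 P G X -> L2 P G Y -> L2 P G (fun w => X w + s *: Y w).
Proof.
move=> LX LY; split=> [A mA|].
  (* [Omega] is given [G] as its sigma-algebra, so that the measurability of linear combinations
     applies to [G] itself. *)
  pose OG := g_sigma_algebraType G.
  have mG (Z : Omega -> V) : L2 P G Z -> measurable_fun [set: OG] (Z : OG -> B).
    move=> [GZ _] _ C mC; rewrite setTI; apply: sub_sigma_algebra; exact: GZ.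
  have := measurable_rV_lin s (mG _ LX) (mG _ LY) measurableT mA.
  by rewrite setTI measurable_g_measurableTypeE.
have [mX mY] := (L2_measurable LX, L2_measurable LY).
have iB : P.-integrable setT
    (fun w => (2 * sqnorm (X w) + 2 * s ^+ 2 * sqnorm (Y w))%:E).
  under eq_fun do rewrite EFinD !EFinM.
  by apply: integrableD => //; apply: integrableZl => //; exact: L2_integrable.
have /integrableP[_] : P.-integrable setT (fun w => (sqnorm (X w + s *: Y w))%:E).
  apply: le_integrable iB => //.
    by apply: measurable_sqnorm; exact: measurable_rV_lin.
  move=> w _; rewrite lee_fin ger0_norm ?sqnorm_ge0 //.
  exact: le_trans (sqnorm_lin_le _ _ _) (ler_norm _).
under eq_integral do rewrite gee0_abs ?lee_fin ?sqnorm_ge0 //.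
by rewrite unlock.
Qed.

Lemma L2normZ (X : Omega -> V) : L2 P G X -> exists2 C : R, 0 <= C &
  forall s : R, L2norm P (fun w => s *: X w) = (`|s| * C)%:E.
Proof.
move=> LX; exists (Num.sqrt (fine ('E_P[fun w => sqnorm (X w)])%E)).
  exact: sqrtr_ge0.
move=> s; rewrite /L2norm.
have -> : ('E_P[fun w => sqnorm (s *: X w)%R] =
    (s ^+ 2 * fine 'E_P[fun w => sqnorm (X w)])%:E)%E.
  rewrite EFinM fineK; last first.
    by rewrite ge0_fin_numE ?expectation_sqnorm_ge0 //; case: LX.
  rewrite unlock -integralZl //; last exact: L2_integrable.
  by apply: eq_integral => w _; rewrite sqnormZ EFinM.
by rewrite /sqrte sqrtrM ?sqr_ge0 // sqrtr_sqr.
Qed.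

End L2_space.

Section Joint_continuity.
Context {R : realType} {d : nat}.

(** Take mu itself as the probability space, with the identity as both random variables. *)
Lemma W2_self_le0 (mu : P2space R d) : (W2 mu mu <= 0)%E.
Proof.
have mid : measurable_fun [set: borelRd R d] (@id (borelRd R d)) by [].
have law : has_law (P2_measure mu) (@id 'rV[R]_d) mu by [].
have := W2_le_L2norm mid mid law law.
rewrite /L2norm unlock (eq_integral (cst 0%E)) ?integral0 ?sqrte0 //.
by move=> w _; rewrite subrr /sqnorm dotpE mul0mx mxE.
Qed.

Lemma jcontinuous_continuous (Z S : normedModType R) (f : Z -> P2space R d -> S)
  mu : jcontinuous f -> continuous (f ^~ mu).
Proof.
move=> jf z; apply/cvgrPdist_lt => e e0.
have [delta d0 dP] := jf z mu e e0.
near=> z'; apply: dP; last by rewrite (le_lt_trans (W2_self_le0 _)) ?lte_fin.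
by near: z'; exact: cvgr_dist_lt.
Unshelve. all: by end_near. Qed.

End Joint_continuity.

(** * Derivatives along a segment of random variables *)

Section Real_derivatives.
Context {R : realType}.
Implicit Types (f df : R -> R) (s l : R).

Lemma is_derive_cvg (V W : normedModType R) (f : V -> W) x v (l : W) :
  h^-1 *: (f (h *: v + x) - f x) @[h --> 0^'] --> l -> is_derive x v f l.
Proof.
by move=> fl; apply: DeriveDef; [exact: cvgP fl | exact: cvg_lim fl].
Qed.

Lemma cvg_is_derive (V W : normedModType R) (f : V -> W) x v (l : W) :
  is_derive x v f l -> h^-1 *: (f (h *: v + x) - f x) @[h --> 0^'] --> l.
Proof. by case=> fd <-. Qed.

Lemma is_derive_eps f s l :
  (forall e : R, 0 < e -> exists2 delta : R, 0 < delta &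
    forall h, `|h| < delta -> `|f (s + h) - f s - h * l| <= e * `|h|) ->
  is_derive s 1 f l.
Proof.
move=> fe; apply: is_derive_cvg; apply/cvgrPdist_le => e e0.
have [delta d0 dP] := fe _ e0.
near=> h.
have h0 : h != 0 by near: h; exact: nbhs_dnbhs_neq.
have : `|h| < delta.
  near: h; apply: dnbhs0_lt; exact: d0.
move/dP; rewrite [_ *: 1]mulr1 (addrC h s) => fh.
have hn : 0 < `|h| by rewrite normr_gt0.
rewrite distrC -(ler_pM2r hn) -normrM mulrBl.
by rewrite [_ *: _]mulrC divfK // (mulrC l).
Unshelve. all: by end_near. Qed.

(** Restricting to the increments 1/(n+1) exhibits a derivative as a limit of a sequence, a form
    that preserves measurability in a parameter. *)
Lemma is_derive_seq (f : R -> R) (s l : R) : is_derive s 1 f l ->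
  (fun n => n.+1%:R * (f (s + n.+1%:R^-1) - f s)) @ \oo --> l.
Proof.
move=> /cvg_is_derive /cvgr_dnbhsP /(_ (fun n => n.+1%:R^-1)) h.
have hn n : n.+1%:R^-1 != 0 :> R by rewrite invr_eq0 pnatr_eq0.
apply: cvg_trans (h (conj hn cvg_harmonic)); apply: near_eq_cvg; near=> n.
by rewrite invrK [_ *: 1]mulr1 (addrC s).
Unshelve. all: by end_near. Qed.

Lemma MVT0 f df : (forall x : R, is_derive x 1 f (df x)) ->
  forall h, exists2 t, `|t| <= `|h| & f h - f 0 = df t * h.
Proof.
move=> fd h.
have fc : continuous f.
  by move=> x; apply/differentiable_continuous/derivable1_diffP; case: (fd x).
have [h0|h0] := leP 0 h.
  have [|t] := @MVT_segment R f df 0 h h0 (fun x _ => fd x).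
    exact: continuous_subspaceT.
  rewrite in_itv /= => /andP[t0 th] E; exists t; last by rewrite E subr0.
  by rewrite !ger0_norm.
have [|t] := @MVT_segment R f df h 0 (ltW h0) (fun x _ => fd x).
  exact: continuous_subspaceT.
rewrite in_itv /= => /andP[th t0] E; exists t.
  by rewrite !ler0_norm ?lerN2 // ltW.
by rewrite -[LHS]opprB E sub0r mulrN opprK.
Qed.

(** Mean value theorem twice: in the first variable for the difference of phi between levels t and
    0, then in the second variable for [pa]. *)
Lemma second_difference (phi pa pab : R -> R -> R) :
  (forall a b : R, is_derive a 1 (phi ^~ b) (pa a b)) ->
  (forall a b : R, is_derive b 1 (pa a) (pab a b)) ->
  forall t, exists a b, [/\ `|a| <= `|t|, `|b| <= `|t| &
    phi t t - phi t 0 - (phi 0 t - phi 0 0) = pab a b * t * t].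
Proof.
move=> da dab t.
have D (x : R) : is_derive x 1 (fun x => phi x t - phi x 0) (pa x t - pa x 0).
  exact: (is_deriveB (da x t) (da x 0)).
have [a at_ ea] := MVT0 D t.
have [b bt eb] := MVT0 (dab a) t.
by exists a, b; split => //; rewrite ea -eb.
Qed.

(** The second difference over the square of side t is symmetric in the two variables. Evaluating it
    in both orders makes [pab] and [pba] agree at two points within t of the origin, and continuity
    there concludes. *)
Lemma schwarz (phi pa pb pab pba : R -> R -> R) :
  (forall a b : R, is_derive a 1 (phi ^~ b) (pa a b)) ->
  (forall a b : R, is_derive b 1 (pa a) (pab a b)) ->
  (forall a b : R, is_derive b 1 (phi a) (pb a b)) ->
  (forall a b : R, is_derive a 1 (pb ^~ b) (pba a b)) ->
  (forall e : R, 0 < e -> exists2 delta : R, 0 < delta & forall a b : R,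
    `|a| < delta -> `|b| < delta -> `|pab 0 0 - pab a b| < e) ->
  (forall e : R, 0 < e -> exists2 delta : R, 0 < delta & forall a b : R,
    `|a| < delta -> `|b| < delta -> `|pba 0 0 - pba a b| < e) ->
  pab 0 0 = pba 0 0.
Proof.
move=> da dab db dba cab cba.
apply/eqP; rewrite -subr_eq0 -normr_le0; apply/ler_addgt0Pr => e e0.
have e20 : 0 < e / 2 by rewrite divr_gt0.
have [d1 d10 c1] := cab _ e20; have [d2 d20 c2] := cba _ e20.
pose t := Num.min d1 d2 / 2.
have m0 : 0 < Num.min d1 d2 by rewrite lt_min d10.
have t0 : 0 < t by rewrite divr_gt0.
have tm : t < Num.min d1 d2 by rewrite /t; lra.
have {tm} [td1 td2] : t < d1 /\ t < d2 by apply/andP; rewrite -lt_min.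
have tE : `|t| = t by rewrite ger0_norm ?ltW.
have [a [b [ha hb E]]] := second_difference da dab t.
have [b' [a' [hb' ha' E']]] := second_difference (fun b a => db a b)
  (fun b a => dba a b) t.
have {}E : pab a b = pba a' b'.
  apply: (mulIf (lt0r_neq0 t0)); apply: (mulIf (lt0r_neq0 t0)).
  by rewrite -E -E'; ring.
rewrite tE in ha hb ha' hb'.
have := c1 a b (le_lt_trans ha td1) (le_lt_trans hb td1).
have := c2 a' b' (le_lt_trans ha' td2) (le_lt_trans hb' td2).
rewrite E !ltr_norml => /andP[? ?] /andP[? ?].
by rewrite add0r ler_norml; apply/andP; split; lra.
Qed.

End Real_derivatives.

Section Directional.
Context {R : realType} {d : nat}.
Local Notation V := 'rV[R]_d.

Lemma diff_grad (f : V -> R) (x v : V) :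
  differentiable f x -> 'd f x v = dotp (grad f x) v.
Proof.
move=> df; rewrite {1}[v]row_sum_delta linear_sum /=.
by apply: eq_bigr => i _; rewrite linearZ /= mxE deriveE // mulrC.
Qed.

Lemma is_derive_line (f : V -> R) (x v : V) (t : R) :
  differentiable f (x + t *: v) ->
  is_derive t 1 (fun s => f (x + s *: v)) (dotp (grad f (x + t *: v)) v).
Proof.
move=> df; apply: is_derive_cvg.
have /cvg_is_derive : is_derive (x + t *: v) v f (dotp (grad f (x + t *: v)) v).
  apply: DeriveDef; first exact: diff_derivable.
  by rewrite deriveE // diff_grad.
apply: cvg_trans; apply: near_eq_cvg; near=> h.
by rewrite [_ *: 1]mulr1 scalerDl addrCA addrC.
Unshelve. all: by end_near. Qed.

Lemma normr_entry_le m n (M : 'M[R]_(m, n)) i j : `|M i j| <= `|M|.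
Proof.
rewrite [leRHS]/Num.norm /= mx_normrE.
exact: (le_bigmax _ (fun ij => `|M ij.1 ij.2|) (i, j)).
Qed.

Lemma norm_dotp_mxnorm (u v : V) : `|dotp u v| <= `|u| * \sum_i `|v 0 i|.
Proof.
rewrite mulr_sumr; apply: le_trans (ler_norm_sum _ _ _) _.
apply: ler_sum => i _; rewrite normrM ler_wpM2r //.
exact: normr_entry_le.
Qed.

End Directional.

Section Chain_rule.
Context {R : realType} {d : nat} {dO : measure_display}
  {Omega : measurableType dO}.
Variables (P : probability Omega R) (G : set (set Omega)).
Hypotheses (G_sigma : sigma_algebra setT G) (G_measurable : G `<=` measurable).
Local Notation V := 'rV[R]_d.
Local Notation B := (borelRd R d).
Local Notation P2 := (P2space R d).

Variables (X dX : Omega -> V) (mu : R -> P2).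
Hypotheses (LX : L2 P G X) (LdX : L2 P G dX).
Hypothesis mu_law : forall s, has_law P (fun w => X w + s *: dX w) (mu s).

(** The two laws are coupled by evaluating both variables at the same w; C is the L^2 norm of
    [dX]. *)
Lemma W2_path : exists2 C : R, 0 <= C &
  forall s h : R, (W2 (mu s) (mu (s + h)) <= (`|h| * C)%:E)%E.
Proof.
have [C C0 CE] := L2normZ G_measurable LdX; exists C => // s h.
have mXs t := L2_measurable G_measurable (L2_lin G_sigma G_measurable t LX LdX).
apply: le_trans (W2_le_L2norm (mXs _) (mXs _) (mu_law _) (mu_law _)) _.
rewrite -normrN -CE le_eqVlt; apply/orP; left; apply/eqP; congr L2norm.
by apply/funext => w; rewrite opprD addrACA subrr add0r -scalerBl opprD addNKr.
Qed.

Lemma W2_path_lt (delta : R) : 0 < delta -> exists2 eta : R, 0 < eta &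
  forall s h, `|h| < eta -> (W2 (mu s) (mu (s + h)) < delta%:E)%E.
Proof.
move=> d0; have [C C0 CE] := W2_path.
(* C may vanish, hence the division by C + 1. *)
have C1 : 0 < C + 1 by rewrite ltr_wpDl.
exists (delta / (C + 1)) => [|s h hd]; first by rewrite divr_gt0.
apply: le_lt_trans (CE s h) _; rewrite lte_fin.
move: hd; rewrite ltr_pdivlMr // => /(le_lt_trans _); apply.
by rewrite ler_wpM2l // lerDl.
Qed.

(** The gradient is tested on the perturbation [h *: dX], whose norm is |h| C: tolerance e / (C + 1)
    there leaves a remainder of at most e |h|. Integrability lets the factor h out of the
    expectation. *)
Lemma wgrad_path (U : P2 -> R) (g : V -> V) (s : R) :
  is_wgrad P G U (mu s) g ->
  P.-integrable setT (fun w => (dotp (g (X w + s *: dX w)) (dX w))%:E) ->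
  forall e : R, 0 < e -> exists2 delta : R, 0 < delta & forall h, `|h| < delta ->
    `|U (mu (s + h)) - U (mu s)
      - h * fine ('E_P[fun w => dotp (g (X w + s *: dX w)%R) (dX w)])%E|
    <= e * `|h|.
Proof.
move=> [_ Ug] ig e e0; have [C C0 CE] := L2normZ G_measurable LdX.
have C1 : 0 < C + 1 by rewrite ltr_wpDl.
have [delta d0 dP] := Ug _ (L2_lin G_sigma G_measurable s LX LdX) (mu_law s)
  (e / (C + 1)) (divr_gt0 e0 C1).
exists (delta / (C + 1)) => [|h hd]; first by rewrite divr_gt0.
have L0 : L2 P G (cst 0 : Omega -> V).
  have := L2_lin G_sigma G_measurable (-1) LX LX.
  by congr L2; apply/funext => w; rewrite scaleN1r subrr.
have Lh : L2 P G (fun w => h *: dX w).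
  have := L2_lin G_sigma G_measurable h L0 LdX.
  by congr L2; apply/funext => w; rewrite add0r.
have hC : `|h| * C < delta.
  move: hd; rewrite ltr_pdivlMr // => /(le_lt_trans _); apply.
  by rewrite ler_wpM2l // lerDl.
have := dP (fun w => h *: dX w) (mu (s + h)) Lh.
rewrite CE lte_fin => /(_ hC) {}dP.
have /dP : has_law P (fun w => X w + s *: dX w + h *: dX w) (mu (s + h)).
  have := mu_law (s + h).
  by congr has_law; apply/funext => w; rewrite scalerDl addrA.
have -> : fine ('E_P[fun w => dotp (g (X w + s *: dX w)%R) (h *: dX w)%R])%E =
    h * fine ('E_P[fun w => dotp (g (X w + s *: dX w)%R) (dX w)])%E.
  rewrite unlock.
  have -> : (\int[P]_w (dotp (g (X w + s *: dX w)%R) (h *: dX w)%R)%:E =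
    h%:E * \int[P]_w (dotp (g (X w + s *: dX w)%R) (dX w))%:E)%E.
    rewrite -integralZl //; apply: eq_integral => w _.
    by rewrite dotpZr EFinM.
  by rewrite fineM // integrable_fin_num.
rewrite -EFinM lee_fin => /le_trans; apply.
have -> : e / (C + 1) * (`|h| * C) = e * `|h| * ((C + 1)^-1 * C) by ring.
rewrite ler_piMr //; first by rewrite mulr_ge0 // ltW.
by rewrite mulrC ler_pdivrMr // mul1r lerDl.
Qed.

(** The three increments are independent because the mean value theorem is applied in x and in p
    separately, with the measure already moved to [mu (s + h)]. The component 0 fills the dummy
    variable y of [is_C1_param]. *)
Lemma path_dotp_continuity (F : V * V * V -> P2 -> V) x p (dx dp v : V) s e :
  jcontinuous F -> 0 < e -> exists2 delta : R, 0 < delta &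
    forall h a b : R, `|h| < delta -> `|a| < delta -> `|b| < delta ->
    `|dotp (F (x + a *: dx, p + b *: dp, 0) (mu (s + h))) v
      - dotp (F (x, p, 0) (mu s)) v| <= e.
Proof.
move=> jF e0; pose c := \sum_i `|v 0 i| + 1.
have c0 : 0 < c by rewrite ltr_wpDl // sumr_ge0.
have [d1 d10 dP] := jF (x, p, 0) (mu s) _ (divr_gt0 e0 c0).
have [d2 d20 WP] := W2_path_lt d10.
pose k := `|dx| + `|dp| + 1; have k0 : 0 < k by rewrite ltr_wpDl // addr_ge0.
have small (r : R) (u : V) : `|r| < d1 / k -> `|u| <= k -> `|r *: u| < d1.
  rewrite ltr_pdivlMr // normrZ => rk uk; apply: le_lt_trans rk.
  by rewrite ler_wpM2l.
exists (Num.min d2 (d1 / k)); first by rewrite lt_min d20 divr_gt0.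
move=> h a b; rewrite !lt_min => /andP[hd _] /andP[_ ad] /andP[_ bd].
rewrite distrC -dotpNl -dotpDl.
apply: le_trans (norm_dotp_mxnorm _ _) _.
have /ltW : `|F (x, p, 0) (mu s) - F (x + a *: dx, p + b *: dp, 0) (mu (s + h))|
    < e / c.
  apply: dP; last exact: WP.
  rewrite !prod_normE /= !gt_max /= !opprD !addNKr !subrr !normrN normr0 d10 andbT.
  by rewrite !small // /k; have := normr_ge0 dx; have := normr_ge0 dp; lra.
rewrite ler_pdivlMr // => /(le_trans _); apply.
by rewrite ler_wpM2l // lerDl.
Qed.

(* The increments in x and p are treated by the mean value theorem and the joint
   continuity of D_x U and D_p U; the increment in mu is taken at fixed (x, p),
   where the definition of the Wasserstein gradient applies directly. *)
Lemma chain_rule (U : V -> V -> P2 -> R) (g : V -> V -> P2 -> V -> V)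
    (x p dx dp : V) (s : R) :
  is_C1 P G U g ->
  P.-integrable setT (fun w =>
    (dotp (g (x + s *: dx) (p + s *: dp) (mu s) (X w + s *: dX w)) (dX w))%:E) ->
  is_derive s 1 (fun t => U (x + t *: dx) (p + t *: dp) (mu t))
    (dotp (Dx U (x + s *: dx) (p + s *: dp) (mu s)) dx
     + dotp (Dp U (x + s *: dx) (p + s *: dp) (mu s)) dp
     + fine ('E_P[fun w => dotp
         (g (x + s *: dx)%R (p + s *: dp)%R (mu s) (X w + s *: dX w)%R) (dX w)])%E).
Proof.
move=> CU ig; apply: is_derive_eps => e e0.
have e30 : 0 < e / 3 by rewrite divr_gt0.
set xs := x + s *: dx; set ps := p + s *: dp.
have [d1 d10 P1] := path_dotp_continuity xs ps dx dp dx s (C1_cont_x CU) e30.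
have [d2 d20 P2'] := path_dotp_continuity xs ps dx dp dp s (C1_cont_p CU) e30.
have [d3 d30 P3] := wgrad_path (C1_diff_mu CU xs ps (mu s) 0) ig e30.
exists (Num.min d1 (Num.min d2 d3)); first by rewrite !lt_min d10 d20 d30.
move=> h; rewrite !lt_min => /and3P[h1 h2 h3].
have xE : x + (s + h) *: dx = xs + h *: dx by rewrite scalerDl addrA.
have pE : p + (s + h) *: dp = ps + h *: dp by rewrite scalerDl addrA.
rewrite xE pE.
(* Order of the telescoping: x moves while p and the measure are already at s + h, then p moves with
   x back at s, and the measure moves last. *)
have [a ah aE] := MVT0 (fun a : R =>
  is_derive_line (C1_diff_x CU (xs + a *: dx) (ps + h *: dp) (mu (s + h)) 0)) h.
have [b bh bE] := MVT0 (fun b : R =>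
  is_derive_line (C1_diff_p CU xs (ps + b *: dp) (mu (s + h)) 0)) h.
have := P1 h a h h1 (le_lt_trans ah h1) h1.
have := P2' h 0 b h2.
rewrite normr0 scale0r addr0 => /(_ d20 (le_lt_trans bh h2)).
have := P3 h h3; move: aE bE; rewrite /= !scale0r !addr0 => aE bE.
rewrite /Dx /Dp /=.
set A1 := dotp (grad _ (xs + a *: dx)) dx in aE *.
set A2 := dotp (grad _ (ps + b *: dp)) dp in bE *.
set L1 := dotp (grad _ xs) dx; set L2 := dotp (grad _ ps) dp; set L3 := fine _.
move=> H3 H2 H1.
rewrite (_ : _ - _ - _ = (A1 - L1) * h + (A2 - L2) * h +
  (U xs ps (mu (s + h)) - U xs ps (mu s) - h * L3)); last by lra.
have -> : e * `|h| = e / 3 * `|h| + e / 3 * `|h| + e / 3 * `|h| by field.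
apply: le_trans (ler_normD _ _) _; apply: lerD => //.
apply: le_trans (ler_normD _ _) _; rewrite !normrM.
by apply: lerD; rewrite ler_wpM2r.
Qed.

End Chain_rule.

(** * Integration over Omega *)

Section Integrals.
Context {R : realType} {dO : measure_display} {Omega : measurableType dO}.
Variable P : probability Omega R.

(** The integral of a nonnegative function is a supremum over the simple functions below it, and
    enlarging the function only enlarges that family. *)
Lemma ge0_le_integral_nonmeasurable (f g : Omega -> \bar R) :
  (forall w, 0 <= f w)%E -> (forall w, f w <= g w)%E ->
  (\int[P]_w f w <= \int[P]_w g w)%E.
Proof.
move=> f0 fg; have g0 w : (0 <= g w)%E by exact: le_trans (fg w).
rewrite !ge0_integralTE //; apply: le_ereal_sup => _ [h hf <-].
by exists h => // x; exact: le_trans (hf x) (fg x).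
Qed.

(** The mean value theorem in s, for each w, bounds |h(s) - h(0)| by |s| K, so the increment has a
    finite expectation. Differentiating under the integral and using the mean value theorem once
    more writes E[h(1) - h(0)] as E[h'(t)] for some t. *)
Lemma integral_increment_ge0 (h h' : Omega -> R -> R) (K : Omega -> R) :
  (forall w (s : R), is_derive s 1 (h w) (h' w s)) ->
  (forall s, measurable_fun setT (h ^~ s)) ->
  P.-integrable setT (EFin \o K) ->
  (forall w s, `|h' w s| <= K w) ->
  (forall s, 0 <= \int[P]_w (h' w s)) ->
  (0 <= \int[P]_w (h w 1 - h w 0)%:E)%E.
Proof.
move=> hd mh iK hK h'0.
have K0 w : 0 <= K w by exact: le_trans (hK w 0).
pose f s w := h w s - h w 0.
have fd w (s : R) : is_derive s 1 (f ^~ w) (h' w s).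
  rewrite -[h' w s]subr0.
  exact: (is_deriveB (hd w s) (is_derive_cst (h w 0) s 1)).
have intf s : P.-integrable setT (EFin \o f s).
  have iKs := integrableZl measurableT (`|s| : R) iK.
  apply: le_integrable iKs => //.
    by apply/measurable_EFinP; exact: measurable_funB.
  move=> w _; rewrite /= lee_fin.
  have [t _] := MVT0 (hd w) s; rewrite -/(f s w) => ->.
  by rewrite normrM mulrC [leRHS]ger0_norm ?mulr_ge0 // ler_wpM2l.
have f1E (s : R) w : partial1of2 f s w = h' w s.
  by rewrite partial1of2E; case: (fd w s).
pose F s := \int[P]_w f s w.
have Fd (a : R) : is_derive a 1 F (\int[P]_w (h' w a)).
  have aI : `]a - 1, a + 1[%classic a.
    by rewrite /= in_itv /=; apply/andP; split; lra.
  have h1 : forall x, `]a - 1, a + 1[%classic x -> P.-integrable setT (EFin \o f x).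
    by move=> x _; exact: intf.
  have h2 : forall x w, `]a - 1, a + 1[%classic x -> setT w ->
      derivable (f ^~ w) x 1.
    by move=> x w _ _; case: (fd w x).
  have h3 : forall x w, `]a - 1, a + 1[%classic x -> setT w ->
      `|partial1of2 f x w| <= K w.
    by move=> x w _ _; rewrite f1E.
  apply: DeriveDef.
    exact: (derivable_under_integral measurableT aI h1 h2 K0 iK h3).
  rewrite -derive1E (differentiation_under_integral measurableT aI h1 h2 K0 iK h3).
  by apply: eq_Rintegral => w _; rewrite f1E.
have F0 : F 0 = 0.
  rewrite /F /Rintegral (eq_integral (cst 0%E)) ?integral0 // => w _.
  by rewrite /f subrr.
have F01 : 0 <= F 1.
  have [t _] := MVT0 Fd 1; rewrite F0 subr0 mulr1 => ->; exact: h'0.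
have := intf 1 => /(integrable_fin_num measurableT) fin.
by rewrite -(fineK fin) lee_fin.
Qed.

End Integrals.

Section Matrix_bounds.
Context {R : realType} {d : nat}.
Implicit Types (u v : 'rV[R]_d) (M : 'M[R]_d).

(** Passes from the gradient of one component, stored as a column, to a coordinate of the row-vector
    product. *)
Lemma dotp_col M v j : dotp (col j M)^T v = (v *m M) 0 j.
Proof. by rewrite mxE; apply: eq_bigr => i _; rewrite !mxE mulrC. Qed.

Lemma mulmx_coord_le M v j C : `|M| <= C ->
  `|(v *m M) 0 j| <= C * d%:R * (1 + sqnorm v).
Proof.
move=> MC; have -> : C * d%:R * (1 + sqnorm v) = \sum_(i < d) C * (1 + sqnorm v).
  by rewrite sumr_const card_ord -[RHS]mulr_natr mulrAC.
rewrite mxE; apply: le_trans (ler_norm_sum _ _ _) _.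
apply: ler_sum => i _; rewrite normrM mulrC ler_pM ?normr_coord_le //.
exact: le_trans (normr_entry_le _ _ _) MC.
Qed.

Lemma dotp_mulmx_le M v u C : `|M| <= C ->
  `|dotp (v *m M) u| <= C * (d * d)%:R * (sqnorm v + sqnorm u).
Proof.
move=> MC; have -> : C * (d * d)%:R * (sqnorm v + sqnorm u) =
    \sum_(j < d) \sum_(i < d) C * (sqnorm v + sqnorm u).
  by rewrite !sumr_const !card_ord -!mulrnA -[RHS]mulr_natr mulrAC.
 apply: le_trans (ler_norm_sum _ _ _) _; apply: ler_sum => j _.
rewrite mxE mulr_suml; apply: le_trans (ler_norm_sum _ _ _) _.
apply: ler_sum => i _; rewrite (mulrC (v 0 i)) -mulrA normrM.
apply: ler_pM => //; first exact: le_trans (normr_entry_le _ _ _) MC.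
have := sqr_coord_le v i; have := sqr_coord_le u j.
have := sqr_ge0 (v 0 i - u 0 j); have := sqr_ge0 (v 0 i + u 0 j).
have := sqr_ge0 (v 0 i); have := sqr_ge0 (u 0 j).
by rewrite ler_norml => *; apply/andP; split; lra.
Qed.

Lemma sqnorm_le_coord u (K : R) : (forall j, `|u 0 j| <= K) ->
  sqnorm u <= d%:R * K ^+ 2.
Proof.
move=> kK; have -> : d%:R * K ^+ 2 = \sum_(j < d) K ^+ 2.
  by rewrite sumr_const card_ord mulr_natl.
 apply: ler_sum => j _.
by rewrite -expr2 -[leLHS]real_normK ?num_real // lerXn2r ?nnegrE //
  (le_trans _ (kK j)).
Qed.

End Matrix_bounds.

Section Copy_expectation.
Context {R : realType} {d : nat} {dO : measure_display}
  {Omega : measurableType dO}.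
Variables (P : probability Omega R) (G : set (set Omega)).
Hypotheses (G_sigma : sigma_algebra setT G) (G_measurable : G `<=` measurable).
Local Notation V := 'rV[R]_d.
Local Notation B := (borelRd R d).
Local Notation P2 := (P2space R d).

Lemma measurable_jcontinuous (F : V * V * V -> P2 -> R) mu (X Y : Omega -> V) :
  jcontinuous F ->
  measurable_fun [set: Omega] (X : Omega -> B) ->
  measurable_fun [set: Omega] (Y : Omega -> B) ->
  measurable_fun setT (fun w => F (X w, Y w, 0) mu).
Proof.
move=> jF; apply: (@measurable_continuous_rV2 _ _ _ _ (fun z => F (z, 0) mu)).
move=> z; apply: (@continuous_comp _ _ _ (fun z => (z, 0 : V)) (F ^~ mu)).
  exact: cvg_pair (@cvg_id _ _) (cvg_cst _).
exact: jcontinuous_continuous.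
Qed.

Lemma jcontinuous_coord (Z : normedModType R) (F : Z -> P2 -> V) i :
  jcontinuous F -> jcontinuous (fun z mu => F z mu 0 i).
Proof.
move=> jF z mu e e0; have [delta d0 dP] := jF z mu e e0.
exists delta => // z' mu' zz' mm'; apply: le_lt_trans (dP z' mu' zz' mm').
by apply: le_trans (normr_entry_le _ 0 i); rewrite !mxE.
Qed.

Lemma sqnorm_affine_integrable (a b : R) (X : Omega -> V) : L2 P G X ->
  P.-integrable setT (fun w => (a + b * sqnorm (X w))%:E).
Proof.
move=> LX; under eq_fun do rewrite EFinD EFinM.
apply: integrableD => //; first exact: finite_measure_integrable_cst.
by apply: integrableZl => //; exact: (L2_integrable G_measurable).
Qed.

Section Bounded_kernel.
Variables (U : 'I_d -> V -> V -> P2 -> R) (M : V -> V -> P2 -> V -> 'M[R]_d).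
Variable C : R.
Hypothesis UC1 : forall j,
  is_C1 P G (U j) (fun x p mu y => (col j (M x p mu y))^T).
Hypothesis MC : forall x p mu y, `|M x p mu y| <= C.
Variables (dX : Omega -> V).
Hypothesis LdX : L2 P G dX.

Lemma measurable_kernel x p mu (X : Omega -> V) j :
  measurable_fun [set: Omega] (X : Omega -> B) ->
  measurable_fun setT (fun w => (dX w *m M x p mu (X w)) 0 j).
Proof.
move=> mX; under eq_fun do rewrite -dotp_col.
apply: measurable_dotp; last exact: (L2_measurable G_measurable LdX).
apply: measurable_rV => i.
have jg := jcontinuous_coord i (C1_cont_mu (UC1 j)).
apply: (@measurable_continuous_rV2 _ _ _ _
  (fun z : V * V => (col j (M x p mu z.1))^T 0 i) _ _ _ mX mX).
move=> z; apply: (@continuous_comp _ _ _ (fun z : V * V => (x, p, 0 : V, z.1))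
  (fun z : V * V * V * V => (col j (M z.1.1.1 z.1.1.2 mu z.2))^T 0 i)).
  exact: cvg_pair (cvg_cst _) cvg_fst.
exact: (jcontinuous_continuous jg (mu := mu)).
Qed.

Let bound w := C * d%:R * (1 + sqnorm (dX w)).

Let bound_integrable : P.-integrable setT (EFin \o bound).
Proof.
have := sqnorm_affine_integrable (C * d%:R) (C * d%:R) LdX.
by apply: eq_integrable => // w _; rewrite /= /bound mulrDr mulr1.
Qed.

Lemma kernel_integrable x p mu (X : Omega -> V) j :
  measurable_fun [set: Omega] (X : Omega -> B) ->
  P.-integrable setT (fun w => ((dX w *m M x p mu (X w)) 0 j)%:E).
Proof.
move=> mX; apply: le_integrable bound_integrable => //.
  by apply/measurable_EFinP; exact: measurable_kernel.
move=> w _; rewrite /= lee_fin.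
exact: le_trans (mulmx_coord_le _ _ (MC _ _ _ _)) (ler_norm _).
Qed.

(** As [M] is bounded, the integrand is dominated by an integrable function of the copy of [dX]
    alone. One constant therefore serves all positions and laws, hence all times s of the path. *)
Lemma copy_expect_bounded : exists K : R, forall X Q mu w j,
  measurable_fun [set: Omega] (X : Omega -> B) ->
  `|copy_expect P M X Q mu dX w 0 j| <= K.
Proof.
exists (\int[P]_w bound w) => X Q mu w j mX; rewrite mxE unlock.
have iM := kernel_integrable (X w) (Q w) mu j mX.
apply: le_trans (le_normr_Rintegral measurableT iM) _.
apply: le_Rintegral => //; last by move=> w' _; exact: mulmx_coord_le.
by apply: eq_integrable (integrable_abse iM).
Qed.

End Bounded_kernel.
End Copy_expectation.

(** * Monotonicity along the segment *)

Section Mixed_derivatives.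
Context {R : realType} {d : nat}.
Local Notation V := 'rV[R]_d.
Local Notation P2 := (P2space R d).

Lemma continuous_dotp_mulmx (M : V * V -> 'M[R]_d) (v u : V) :
  (forall i j, continuous (fun z => M z i j)) ->
  continuous (fun z => dotp (v *m M z) u).
Proof.
move=> cM z; rewrite /dotp.
apply: (@cvg_big _ _ _ _ _ add_continuous) => j _.
under eq_fun do rewrite mxE; rewrite mxE.
apply: (@cvgM _ _ _ _ _ (cst (u 0 j))); last exact: cvg_cst.
apply: (@cvg_big _ _ _ _ _ add_continuous) => i _.
apply: (@cvgM _ _ _ _ (cst (v 0 i))); [exact: cvg_cst | exact: cM].
Qed.

Lemma continuous_line (f : V * V -> R) (x p u v : V) : continuous f ->
  forall e : R, 0 < e -> exists2 delta : R, 0 < delta & forall a b : R,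
    `|a| < delta -> `|b| < delta ->
    `|f (x, p) - f (x + a *: u, p + b *: v)| < e.
Proof.
move=> cf e e0.
have /cvgrPdist_lt /(_ e e0) /nbhs_ballP[r r0 rP] := cf (x, p).
pose k := `|u| + `|v| + 1; have k0 : 0 < k by rewrite ltr_wpDl // addr_ge0.
have small (c : R) (y : V) : `|c| < r / k -> `|y| <= k -> `|c *: y| < r.
  rewrite ltr_pdivlMr // normrZ => ck yk; apply: le_lt_trans ck.
  by rewrite ler_wpM2l.
exists (r / k) => [|a b ad bd]; first by rewrite divr_gt0.
apply: rP; rewrite -ball_normE /= prod_normE /= gt_max /= !opprD !addNKr !normrN.
by rewrite !small // /k; have := normr_ge0 u; have := normr_ge0 v; lra.
Qed.

Lemma is_derive_dotp (n : nat) (f : 'I_n -> R -> R) (df : 'I_n -> R) (s : R)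
    (v : 'rV[R]_n) :
  (forall j, is_derive s 1 (f j) (df j)) ->
  is_derive s 1 (fun t => \sum_j f j t * v 0 j) (\sum_j df j * v 0 j).
Proof.
move=> fd; rewrite -fct_sumE; apply: is_derive_sum => j.
have := is_deriveZ (v 0 j) (fd j); rewrite [_ *: df j]mulrC.
by congr (is_derive _ _ _ _); apply/funext => t; rewrite mulrC.
Qed.

Lemma is_derive_dotp_line (F : V -> V) (x v u : V) (t : R) :
  (forall j y, differentiable (fun y => F y 0 j) y) ->
  is_derive t 1 (fun s => dotp (F (x + s *: v)) u)
    (dotp (v *m jac F (x + t *: v)) u).
Proof.
move=> dF.
have := is_derive_dotp u (fun j => is_derive_line (dF j (x + t *: v))).
congr (is_derive _ _ _ _); apply: eq_bigr => j _; congr (_ * _).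
by rewrite mxE; apply: eq_bigr => i _; rewrite !mxE mulrC.
Qed.

Context {dO : measure_display} {Omega : measurableType dO}.
Variables (P : probability Omega R) (G : set (set Omega)).

(** Schwarz's theorem for H(x + a u, p + b v, mu) in the real variables a and b. Symmetry is stated
    for the bilinear forms, the shape in which the mixed terms occur in h'. *)
Lemma mixed_derivative_symmetric H Dmu Dxmu Dpmu Dmumu (x p u v : V) (mu : P2) :
  is_C2 P G H Dmu Dxmu Dpmu Dmumu ->
  dotp (v *m jac (fun q => Dx H x q mu) p) u =
  dotp (u *m jac (fun y => Dp H y p mu) x) v.
Proof.
move=> HC2; have H1 := C2_C1 HC2.
have cF (F : V * V * V -> P2 -> V) i : jcontinuous F ->
    continuous (fun z : V * V => F (z, 0) mu 0 i).
  move=> jF z; apply: (@continuous_comp _ _ _ (fun z => (z, 0 : V))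
    (fun z => F z mu 0 i)); first exact: cvg_pair (@cvg_id _ _) (cvg_cst _).
  exact: (jcontinuous_continuous (jcontinuous_coord i jF) (mu := mu)).
pose Mpx (z : V * V) := jac (fun q => Dx H z.1 q mu) z.2.
pose Mxp (z : V * V) := jac (fun y => Dp H y z.2 mu) z.1.
(* This entry is coordinate i of the p-gradient of the j-th component of D_xH. *)
have cpx i j : continuous (fun z => Mpx z i j).
  apply: (eq_rect _ (fun f : V * V -> R => continuous f)
    (cF _ i (C1_cont_p (C2_x HC2 j)))).
  by apply/funext => z; rewrite [RHS]mxE.
have cxp i j : continuous (fun z => Mxp z i j).
  apply: (eq_rect _ (fun f : V * V -> R => continuous f)
    (cF _ i (C1_cont_x (C2_p HC2 j)))).
  by apply/funext => z; rewrite [RHS]mxE.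
have := @schwarz R (fun a b => H (x + a *: u) (p + b *: v) mu)
  (fun a b => dotp (Dx H (x + a *: u) (p + b *: v) mu) u)
  (fun a b => dotp (Dp H (x + a *: u) (p + b *: v) mu) v)
  (fun a b => dotp (v *m Mpx (x + a *: u, p + b *: v)) u)
  (fun a b => dotp (u *m Mxp (x + a *: u, p + b *: v)) v).
rewrite !scale0r !addr0; apply.
- move=> a b; apply: (is_derive_line (f := fun y => H y (p + b *: v) mu)).
  exact: (C1_diff_x H1 _ _ _ 0).
- move=> a b; apply: (is_derive_dotp_line (F := fun q => Dx H (x + a *: u) q mu)).
  by move=> j q; exact: (C1_diff_p (C2_x HC2 j) _ _ _ 0).
- move=> a b; apply: (is_derive_line (f := fun q => H (x + a *: u) q mu)).
  exact: (C1_diff_p H1 _ _ _ 0).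
- move=> a b; apply: (is_derive_dotp_line (F := fun y => Dp H y (p + b *: v) mu)).
  by move=> j y; exact: (C1_diff_x (C2_p HC2 j) _ _ _ 0).
- exact: (continuous_line x p u v (continuous_dotp_mulmx cpx)).
- exact: (continuous_line x p u v (continuous_dotp_mulmx cxp)).
Qed.

End Mixed_derivatives.

Section Path_derivative.
Context {R : realType} {d : nat} {dO : measure_display}
  {Omega : measurableType dO}.
Variables (P : probability Omega R) (G : set (set Omega)).
Hypotheses (G_sigma : sigma_algebra setT G) (G_measurable : G `<=` measurable).
Local Notation V := 'rV[R]_d.
Local Notation B := (borelRd R d).
Local Notation P2 := (P2space R d).

Variables (X dX Q dQ : Omega -> V) (mu : R -> P2).
Hypotheses (LX : L2 P G X) (LdX : L2 P G dX) (LQ : L2 P G Q) (LdQ : L2 P G dQ).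
Hypothesis mu_law : forall s, has_law P (fun w => X w + s *: dX w) (mu s).
Local Notation Xs s := (fun w => X w + s *: dX w).
Local Notation Qs s := (fun w => Q w + s *: dQ w).

Let mXs s : measurable_fun [set: Omega] (Xs s : Omega -> B).
Proof.
apply: measurable_rV_lin; first exact: (L2_measurable G_measurable LX).
exact: (L2_measurable G_measurable LdX).
Qed.

Let mQs s : measurable_fun [set: Omega] (Qs s : Omega -> B).
Proof.
apply: measurable_rV_lin; first exact: (L2_measurable G_measurable LQ).
exact: (L2_measurable G_measurable LdQ).
Qed.

Section Kernel.
Variables (W : V -> V -> P2 -> V) (M : V -> V -> P2 -> V -> 'M[R]_d) (C : R).
Hypothesis WC1 : forall j,
  is_C1 P G (fun x p nu => W x p nu 0 j) (fun x p nu y => (col j (M x p nu y))^T).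
Hypothesis MC : forall x p nu y, `|M x p nu y| <= C.

Let kernel_int x p s j : P.-integrable setT
  (fun w => (dotp (col j (M x p (mu s) (Xs s w)))^T (dX w))%:E).
Proof.
have := kernel_integrable G_measurable WC1 MC LdX x p (mu s) j (mXs s).
by apply: eq_integrable => // w _; rewrite dotp_col.
Qed.

Lemma copy_expect_coord s w j : copy_expect P M (Xs s) (Qs s) (mu s) dX w 0 j =
  fine ('E_P[fun w' => dotp (col j (M (Xs s w) (Qs s w) (mu s) (Xs s w')))^T
                            (dX w')])%E.
Proof.
by rewrite mxE; congr (fine 'E_P[_])%E; apply/funext => w'; rewrite dotp_col.
Qed.

(** Kept general in [W] to serve both D_pH paired with [dQ w] and D_xH paired with [dX w]; with w
    fixed, v does not move along the path. *)
Lemma is_derive_path_dotp w (v : V) (s : R) :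
  is_derive s 1 (fun t => dotp (W (Xs t w) (Qs t w) (mu t)) v)
    (dotp (dX w *m jac (fun y => W y (Qs s w) (mu s)) (Xs s w)
           + dQ w *m jac (fun q => W (Xs s w) q (mu s)) (Qs s w)
           + copy_expect P M (Xs s) (Qs s) (mu s) dX w) v).
Proof.
have := is_derive_dotp v (fun j => chain_rule G_sigma G_measurable LX LdX mu_law
  (WC1 j) (kernel_int (Xs s w) (Qs s w) s j)).
congr (is_derive _ _ _ _); apply: eq_bigr => j _; congr (_ * _).
rewrite !mxE -copy_expect_coord mxE; congr (_ + _ + _);
  by apply: eq_bigr => i _; rewrite !mxE mulrC.
Qed.

(* Each coordinate is a limit of difference quotients in mu, which avoids
   Fubini's theorem. *)
Lemma measurable_copy_expect s : measurable_fun [set: Omega]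
  (copy_expect P M (Xs s) (Qs s) (mu s) dX : Omega -> B).
Proof.
apply: measurable_rV => j.
pose f n w := n.+1%:R * (W (Xs s w) (Qs s w) (mu (s + n.+1%:R^-1)) 0 j
                         - W (Xs s w) (Qs s w) (mu s) 0 j).
apply: (measurable_fun_cvg (h := f)).
  move=> n; have mW nu : measurable_fun setT (fun w => W (Xs s w) (Qs s w) nu 0 j).
    exact: (measurable_jcontinuous nu (C1_cont (WC1 j)) (mXs s) (mQs s)).
  by apply: measurable_funM => //; exact: measurable_funB.
move=> w _; rewrite copy_expect_coord.
apply: (is_derive_seq (f := fun t => W (Xs s w) (Qs s w) (mu t) 0 j)).
apply: is_derive_eps => e e0.
exact: (wgrad_path G_sigma G_measurable LX LdX mu_law
  (C1_diff_mu (WC1 j) (Xs s w) (Qs s w) (mu s) 0)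
  (kernel_int (Xs s w) (Qs s w) s j) e0).
Qed.

Lemma copy_expect_dotp_le : exists a : R, forall s w u,
  `|dotp (copy_expect P M (Xs s) (Qs s) (mu s) dX w) u| <= a + sqnorm u.
Proof.
have [K KP] := copy_expect_bounded G_measurable WC1 MC LdX.
exists (d%:R * K ^+ 2) => s w u.
apply: le_trans (normr_dotp_le _ _) _; rewrite lerD2r.
by apply: sqnorm_le_coord => j; exact: KP.
Qed.

End Kernel.
End Path_derivative.

Lemma measurable_dotp_mulmx (R : realType) (d : nat) dO (Omega : measurableType dO)
    (M : Omega -> 'M[R]_d) (v u : Omega -> 'rV[R]_d) :
  (forall i j, measurable_fun setT (fun w => M w i j)) ->
  measurable_fun [set: Omega] (v : Omega -> borelRd R d) ->
  measurable_fun [set: Omega] (u : Omega -> borelRd R d) ->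
  measurable_fun setT (fun w => dotp (v w *m M w) (u w)).
Proof.
move=> mM mv mu; apply: measurable_dotp => //; apply: measurable_rV => j.
under eq_fun do rewrite mxE.
apply: measurable_sum => i; apply: measurable_funM => //.
exact: measurable_rV_coord.
Qed.

Section Monotonicity_along_path.
Context {R : realType} {d : nat} {dO : measure_display}
  {Omega : measurableType dO}.
Variables (P : probability Omega R) (G : set (set Omega)).
Hypotheses (G_sigma : sigma_algebra setT G) (G_measurable : G `<=` measurable).
Local Notation V := 'rV[R]_d.
Local Notation B := (borelRd R d).
Local Notation P2 := (P2space R d).

Variables (H : V -> V -> P2 -> R) (Dmu : V -> V -> P2 -> V -> V).
Variables (Dxmu Dpmu : V -> V -> P2 -> V -> 'M[R]_d).
Variable Dmumu : V -> V -> P2 -> V -> V -> 'M[R]_d.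
Hypothesis H_C2 : is_C2 P G H Dmu Dxmu Dpmu Dmumu.
Variables (c0 Cxm Cxx Cpp Cpm : R).
Hypothesis c0_gt0 : 0 < c0.
Hypothesis H_convex : forall x p nu, psdmx (Dpp H x p nu - c0%:M).
Hypothesis Dxmu_bounded : forall x p nu y, `|Dxmu x p nu y| <= Cxm.
Hypothesis Dxx_bounded : forall x p nu, `|Dxx H x p nu| <= Cxx.
Hypothesis Dpp_bounded : forall x p nu, `|Dpp H x p nu| <= Cpp.
Hypothesis Dpmu_bounded : forall x p nu y, `|Dpmu x p nu y| <= Cpm.
Hypothesis H_monotone : forall (X dX Q : Omega -> V) (nu : P2),
  L2 P G X -> L2 P G dX -> L2 P G Q -> has_law P X nu ->
  ('E_P[fun w => (dotp (copy_expect P Dxmu X Q nu dX w) (dX w)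
                  + dotp (dX w *m Dxx H (X w) (Q w) nu) (dX w))%R]
   <= - ((4^-1)%:E *
      'E_P[fun w => sqnorm (copy_expect P Dpmu X Q nu dX w
                            *m invsqrtmx (Dpp H (X w) (Q w) nu))]))%E.

Variables (X dX Q dQ : Omega -> V) (mu : R -> P2).
Hypotheses (LX : L2 P G X) (LdX : L2 P G dX) (LQ : L2 P G Q) (LdQ : L2 P G dQ).
Hypothesis mu_law : forall s, has_law P (fun w => X w + s *: dX w) (mu s).
Local Notation Xs s := (fun w => X w + s *: dX w).
Local Notation Qs s := (fun w => Q w + s *: dQ w).

Let h w s := dotp (Dp H (Xs s w) (Qs s w) (mu s)) (dQ w)
             - dotp (Dx H (Xs s w) (Qs s w) (mu s)) (dX w).
(** What remains of h' once the mixed terms are gone: [pp] is the quadratic expression of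
    [completed_square_ge0] in [dQ w], and [xx] is the left integrand of [H_monotone] at time s. *)
Let pp w s := dotp (dQ w *m Dpp H (Xs s w) (Qs s w) (mu s)) (dQ w)
  + dotp (copy_expect P Dpmu (Xs s) (Qs s) (mu s) dX w) (dQ w).
Let xx w s := dotp (copy_expect P Dxmu (Xs s) (Qs s) (mu s) dX w) (dX w)
  + dotp (dX w *m Dxx H (Xs s w) (Qs s w) (mu s)) (dX w).

Let h_derive w (s : R) : is_derive s 1 (h w) (pp w s - xx w s).
Proof.
have dp := is_derive_path_dotp G_sigma G_measurable Q dQ LX LdX mu_law
  (C2_p H_C2) Dpmu_bounded w (dQ w) s.
have dx := is_derive_path_dotp G_sigma G_measurable Q dQ LX LdX mu_law
  (C2_x H_C2) Dxmu_bounded w (dX w) s.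
(* Here [a1] and [b2] carry the mixed derivatives: the x-derivative of D_pH along [dX w] and the
   p-derivative of D_xH along [dQ w]. *)
have cancel (u v a1 b1 c1 a2 b2 c2 : V) : dotp b2 u = dotp a1 v ->
    dotp (a1 + b1 + c1) v - dotp (a2 + b2 + c2) u =
    dotp b1 v + dotp c1 v - (dotp c2 u + dotp a2 u).
  by rewrite !dotpDl => ->; ring.
apply: (is_derive_eq (is_deriveB dp dx)); apply: cancel.
exact: (mixed_derivative_symmetric _ _ _ _ _ H_C2).
Qed.

Let mXs s : measurable_fun [set: Omega] (Xs s : Omega -> B).
Proof.
exact: (L2_measurable G_measurable (L2_lin G_sigma G_measurable s LX LdX)).
Qed.

Let mQs s : measurable_fun [set: Omega] (Qs s : Omega -> B).
Proof.
exact: (L2_measurable G_measurable (L2_lin G_sigma G_measurable s LQ LdQ)).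
Qed.

Let mdX : measurable_fun [set: Omega] (dX : Omega -> B).
Proof. exact: (L2_measurable G_measurable LdX). Qed.

Let mdQ : measurable_fun [set: Omega] (dQ : Omega -> B).
Proof. exact: (L2_measurable G_measurable LdQ). Qed.

Let h_measurable s : measurable_fun setT (h ^~ s).
Proof.
apply: measurable_funB; apply: measurable_dotp => //; apply: measurable_rV => j.
  exact: (measurable_jcontinuous (mu s) (C1_cont (C2_p H_C2 j)) (mXs s) (mQs s)).
exact: (measurable_jcontinuous (mu s) (C1_cont (C2_x H_C2 j)) (mXs s) (mQs s)).
Qed.

Let pp_measurable s : measurable_fun setT (pp ^~ s).
Proof.
apply: measurable_funD.
  apply: measurable_dotp_mulmx => // i j; under eq_fun do rewrite mxE.
  exact: (measurable_jcontinuous (mu s)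
    (jcontinuous_coord i (C1_cont_p (C2_p H_C2 j))) (mXs s) (mQs s)).
apply: measurable_dotp => //.
exact: (measurable_copy_expect G_sigma G_measurable LX LdX LQ LdQ mu_law
  (C2_p H_C2) Dpmu_bounded).
Qed.

Let xx_measurable s : measurable_fun setT (xx ^~ s).
Proof.
apply: measurable_funD; last first.
  apply: measurable_dotp_mulmx => // i j; under eq_fun do rewrite mxE.
  exact: (measurable_jcontinuous (mu s)
    (jcontinuous_coord i (C1_cont_x (C2_x H_C2 j))) (mXs s) (mQs s)).
apply: measurable_dotp => //.
exact: (measurable_copy_expect G_sigma G_measurable LX LdX LQ LdQ mu_law
  (C2_x H_C2) Dxmu_bounded).
Qed.

Let pp_le : exists a b : R, forall w s, `|pp w s| <= a + b * sqnorm (dQ w).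
Proof.
have [a aP] := copy_expect_dotp_le G_measurable Q dQ mu LX LdX
  (C2_p H_C2) Dpmu_bounded.
(* The 2 comes from [dotp_mulmx_le] with both vectors equal to [dQ w], the 1 from
   [copy_expect_dotp_le]; the bound is uniform in s. *)
exists a, (Cpp * (d * d)%:R * 2 + 1) => w s; apply: le_trans (ler_normD _ _) _.
have := aP s w (dQ w).
have := dotp_mulmx_le (dQ w) (dQ w) (Dpp_bounded (Xs s w) (Qs s w) (mu s)).
lra.
Qed.

Let xx_le : exists a b : R, forall w s, `|xx w s| <= a + b * sqnorm (dX w).
Proof.
have [a aP] := copy_expect_dotp_le G_measurable Q dQ mu LX LdX
  (C2_x H_C2) Dxmu_bounded.
exists a, (Cxx * (d * d)%:R * 2 + 1) => w s; apply: le_trans (ler_normD _ _) _.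
have := aP s w (dX w).
have := dotp_mulmx_le (dX w) (dX w) (Dxx_bounded (Xs s w) (Qs s w) (mu s)).
lra.
Qed.

Let affine_bounded_integrable (f : Omega -> R) (a b : R) (Y : Omega -> V) :
  L2 P G Y -> measurable_fun setT f ->
  (forall w, `|f w| <= a + b * sqnorm (Y w)) -> P.-integrable setT (EFin \o f).
Proof.
move=> LY mf fle.
apply: le_integrable (sqnorm_affine_integrable G_measurable a b LY) => //.
  exact/measurable_EFinP.
by move=> w _; rewrite /= lee_fin; exact: le_trans (fle w) (ler_norm _).
Qed.

Let pp_integrable s : P.-integrable setT (EFin \o pp ^~ s).
Proof.
have [a [b ab]] := pp_le.
exact: (affine_bounded_integrable LdQ (pp_measurable s) (ab ^~ s)).
Qed.

Let xx_integrable s : P.-integrable setT (EFin \o xx ^~ s).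
Proof.
have [a [b ab]] := xx_le.
exact: (affine_bounded_integrable LdX (xx_measurable s) (ab ^~ s)).
Qed.

(* No measurability of the matrix square root is needed: completing the square
   bounds [- 4 pp] by the integrand of H_monotone, and the integral of
   nonnegative functions is monotone without measurability. *)
Let integral_xx_le_pp s : (\int[P]_w (xx w s)%:E <= \int[P]_w (pp w s)%:E)%E.
Proof.
have := H_monotone (L2_lin G_sigma G_measurable s LX LdX) LdX
  (L2_lin G_sigma G_measurable s LQ LdQ) (mu_law s).
rewrite unlock => /le_trans; apply.
pose g w := sqnorm (copy_expect P Dpmu (Xs s) (Qs s) (mu s) dX w
                    *m invsqrtmx (Dpp H (Xs s w) (Qs s w) (mu s))).
change (- ((4^-1)%:E * \int[P]_w (g w)%:E) <= \int[P]_w (pp w s)%:E)%E.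
(* Clipping at 0 is needed because - 4 [pp] may be negative and the comparison with [g] covers
   nonnegative functions. *)
pose m w := Num.max (- 4 * pp w s) 0.
have i4 : P.-integrable setT (fun w => (- 4 * pp w s)%:E).
  by under eq_fun do rewrite EFinM; apply: integrableZl => //; exact: pp_integrable.
have gm : (\int[P]_w (m w)%:E <= \int[P]_w (g w)%:E)%E.
  apply: ge0_le_integral_nonmeasurable => w; rewrite lee_fin.
    by rewrite /m le_max lexx orbT.
  rewrite /m ge_max sqnorm_ge0 andbT.
  have := completed_square_ge0 (dQ w)
    (copy_expect P Dpmu (Xs s) (Qs s) (mu s) dX w) c0_gt0
    (H_convex (Xs s w) (Qs s w) (mu s)).
  by rewrite -/(pp w s) -/(g w); lra.
have im : P.-integrable setT (fun w => (m w)%:E).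
  apply: le_integrable i4 => //.
    apply/measurable_EFinP; apply: measurable_maxr => //.
    by apply: measurable_funM => //; exact: pp_measurable.
  move=> w _; rewrite lee_fin /m ger0_norm ?le_max ?lexx ?orbT //.
  by rewrite ge_max ler_norm normr_ge0.
have m4 : (\int[P]_w (- 4 * pp w s)%:E <= \int[P]_w (m w)%:E)%E.
  by apply: le_integral => // w _; rewrite lee_fin /m le_max lexx.
have {gm}m4 := le_trans m4 gm.
have fpp := integrable_fin_num measurableT (pp_integrable s).
have E4 : (\int[P]_w (- 4 * pp w s)%:E = (- 4)%:E * \int[P]_w (pp w s)%:E)%E.
  have <- := integralZl measurableT (pp_integrable s) (- 4).
  by apply: eq_integral => w _; rewrite EFinM.
move: m4; rewrite E4 -(fineK fpp) -EFinM.
(* The integral of [g] may be infinite; the lower bound is then minus infinity and the claim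
   trivial. *)
case: (\int[P]_w (g w)%:E)%E => [r| |] //=.
  by rewrite !lee_fin; lra.
by rewrite mulry gtr0_sg ?invr_gt0 // mul1e leNye.
Qed.

Lemma monotone_along_path : (0 <= \int[P]_w (h w 1 - h w 0)%:E)%E.
Proof.
have [a [b ab]] := pp_le; have [a' [b' ab']] := xx_le.
have iK := integrableD measurableT (sqnorm_affine_integrable G_measurable a b LdQ)
  (sqnorm_affine_integrable G_measurable a' b' LdX).
apply: (integral_increment_ge0 h_derive h_measurable iK).
  move=> w s; apply: le_trans (ler_normB _ _) _.
  exact: lerD.
move=> s; have := RintegralB measurableT (pp_integrable s) (xx_integrable s).
move=> ->; rewrite subr_ge0; apply: fine_le (integral_xx_le_pp s).
  exact: (integrable_fin_num measurableT (xx_integrable s)).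
exact: (integrable_fin_num measurableT (pp_integrable s)).
Qed.

End Monotonicity_along_path.

Theorem lemma2p7 (R : realType) (d : nat)
  (dO : measure_display) (Omega : measurableType dO) (P : probability Omega R)
  (T : R) (T_ge0 : 0 <= T) (F : R -> set (set Omega))
  (F_filtration : filtration T F) (F0_no_atom : no_atom P (F 0))
  (H : 'rV[R]_d -> 'rV[R]_d -> P2space R d -> R)
  (Dmu : 'rV[R]_d -> 'rV[R]_d -> P2space R d -> 'rV[R]_d -> 'rV[R]_d)
  (Dxmu Dpmu : 'rV[R]_d -> 'rV[R]_d -> P2space R d -> 'rV[R]_d -> 'M[R]_d)
  (Dmumu : 'rV[R]_d -> 'rV[R]_d -> P2space R d -> 'rV[R]_d -> 'rV[R]_d ->
           'M[R]_d)
  (H_C2 : is_C2 P (F T) H Dmu Dxmu Dpmu Dmumu)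
  (c0 : R) (c0_gt0 : 0 < c0)
  (H_convex : forall x p mu, psdmx (Dpp H x p mu - c0%:M))
  (Dxmu_bounded : exists C : R, forall x p mu y, `|Dxmu x p mu y| <= C)
  (Dxx_bounded : exists C : R, forall x p mu, `|Dxx H x p mu| <= C)
  (Dpp_bounded : exists C : R, forall x p mu, `|Dpp H x p mu| <= C)
  (Dpmu_bounded : exists C : R, forall x p mu y, `|Dpmu x p mu y| <= C)
  (H_monotone : forall (X dX Q : Omega -> 'rV[R]_d) (mu : P2space R d),
    L2 P (F T) X -> L2 P (F T) dX -> L2 P (F T) Q -> has_law P X mu ->
    ('E_P[fun w => (dotp (copy_expect P Dxmu X Q mu dX w) (dX w)
                    + dotp (dX w *m Dxx H (X w) (Q w) mu) (dX w))%R]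
     <= - ((4^-1)%:E *
        'E_P[fun w => sqnorm (copy_expect P Dpmu X Q mu dX w
                              *m invsqrtmx (Dpp H (X w) (Q w) mu))]))%E) :
  forall (X1 X2 Q1 Q2 : Omega -> 'rV[R]_d) (mu1 mu2 : P2space R d),
    L2 P (F T) X1 -> L2 P (F T) X2 -> L2 P (F T) Q1 -> L2 P (F T) Q2 ->
    has_law P X1 mu1 -> has_law P X2 mu2 ->
    let A := fun w => dotp (- Dx H (X1 w) (Q1 w) mu1 + Dx H (X2 w) (Q2 w) mu2)
                           (X1 w - X2 w) in
    let B := fun w => dotp (Dp H (X1 w) (Q1 w) mu1 - Dp H (X2 w) (Q2 w) mu2)
                           (Q1 w - Q2 w) in
    (0 <= 'E_P[fun w => (A w + B w)%R])%E /\
    (P.-integrable setT (EFin \o A) -> P.-integrable setT (EFin \o B) ->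
     0 <= 'E_P[A] + 'E_P[B])%E.
Proof.
have [F_sigma F_meas _] := F_filtration.
have TT : 0 <= T <= T by rewrite T_ge0 lexx.
have [Cxm Dxmu_le] := Dxmu_bounded; have [Cxx Dxx_le] := Dxx_bounded.
have [Cpm Dpmu_le] := Dpmu_bounded; have [Cpp Dpp_le] := Dpp_bounded.
move=> X1 X2 Q1 Q2 mu1 mu2 LX1 LX2 LQ1 LQ2 law1 law2 A B.
pose dX w := X1 w - X2 w; pose dQ w := Q1 w - Q2 w.
have L2B Y Z : L2 P (F T) Y -> L2 P (F T) Z -> L2 P (F T) (fun w => Y w - Z w).
  move=> LY LZ; have := L2_lin (F_sigma T TT) (F_meas T TT) (-1) LY LZ.
  by congr L2; apply/funext => w; rewrite scaleN1r.
have LdX : L2 P (F T) dX by exact: L2B.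
have LdQ : L2 P (F T) dQ by exact: L2B.
(* Laws are chosen for every real s, not only on [0, 1], since the derivatives in s are two-sided at
   the endpoints too. *)
have /choice[mu muP] : forall s : R, exists nu : P2space R d,
    [/\ has_law P (fun w => X2 w + s *: dX w) nu,
        s = 0 -> nu = mu2 & s = 1 -> nu = mu1].
  move=> s.
  (* The endpoints must be mu2 and mu1 themselves: a P2space is not determined by
     its values on Borel sets. *)
  have [->|s0] := eqVneq s 0.
    exists mu2; split=> // [|/esym/eqP]; last by rewrite oner_eq0.
    by move: law2; congr has_law; apply/funext => w; rewrite scale0r addr0.
  have [->|s1] := eqVneq s 1.
    exists mu1; split=> // [|/eqP]; last by rewrite oner_eq0.
    by move: law1; congr has_law; apply/funext => w; rewrite scale1r subrKC.
  have Ls := L2_lin (F_sigma T TT) (F_meas T TT) s LX2 LdX.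
  have [nu nuP] := has_law_exists (L2_measurable (F_meas T TT) Ls) Ls.2.
  by exists nu; split=> // /eqP; rewrite ?(negPf s0) ?(negPf s1).
have mu_law s : has_law P (fun w => X2 w + s *: dX w) (mu s) by case: (muP s).
have [_ mu0 _] := muP 0; have [_ _ mu1E] := muP 1.
have := monotone_along_path (F_sigma T TT) (F_meas T TT) H_C2 c0_gt0 H_convex
  Dxmu_le Dxx_le Dpp_le Dpmu_le H_monotone LX2 LdX LQ2 LdQ mu_law.
rewrite mu0 // mu1E //.
under eq_integral => w _.
  rewrite !scale0r !addr0 !scale1r !subrKC.
  over.
move=> ge0.
have AB w : dotp (Dp H (X1 w) (Q1 w) mu1) (dQ w) -
    dotp (Dx H (X1 w) (Q1 w) mu1) (dX w) -
    (dotp (Dp H (X2 w) (Q2 w) mu2) (dQ w) -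
    dotp (Dx H (X2 w) (Q2 w) mu2) (dX w)) = A w + B w.
  by rewrite /A /B !(dotpDl, dotpNl); ring.
have {}ge0 : (0 <= 'E_P[fun w => (A w + B w)%R])%E.
  by rewrite unlock; under eq_integral do rewrite -AB.
split=> // iA iB; move: ge0; rewrite unlock.
by under eq_integral do rewrite EFinD; rewrite integralD.
Qed.
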